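(* Let $n\ge2$ and $1\le k\le n-1$. Then $\mathcal D^\ast_{n,k}$ is a $\bmod 2$-homology sphere. That is, for every face $\sigma$ of $\mathcal D^\ast_{n,k}$ (including $\sigma=\emptyset$, with $\dim\emptyset=-1$), $$H_\ast(\mathrm{link}_{\mathcal D^\ast_{n,k}}(\sigma);\mathbb Z_2)\cong H_\ast(S^{k(n-k)-1-\dim\sigma-1};\mathbb Z_2).$$ In particular, $H_\ast(\mathcal D^\ast_{n,k};\mathbb Z_2)\cong H_\ast(S^{k(n-k)-1};\mathbb Z_2)$.
   Context: Label the vertices of a convex regular $2n$-gon by $1,\dots,2n$ in cyclic order. A segment is a $2$-subset $\{a,b\}\subseteq[2n]$. Two segments cross if their four endpoints are distinct and interleave in the cyclic order. A $(k+1)$-crossing is a set of $k+1$ pairwise crossing segments. The cyclic length of $\{a,b\}$ is $\min(|a-b|,2n-|a-b|)$, and $\Omega_{2n,k}$ is the set of segments of cyclic length $>k$. The $180^\circ$-rotation sends $\{a,b\}$ to $\{a+n,b+n\}$ (indices mod $2n$). $\mathcal F_{n,k}$ is the set of rotation orbits of segments in $\Omega_{2n,k}$. $\mathcal D^\ast_{n,k}$ is the simplicial complex on $\mathcal F_{n,k}$ whose faces are the sets of orbits whose union contains no $(k+1)$-crossing. For a face $\sigma$ of a complex $\Delta$, $\mathrm{link}_\Delta(\sigma)=\{\tau\in\Delta:\tau\cup\sigma\in\Delta,\ \tau\cap\sigma=\emptyset\}$. *)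

(* Defs.v *)
From HB Require Import structures.
From mathcomp Require Import all_boot all_order all_fingroup all_algebra.

Set Implicit Arguments.
Unset Strict Implicit.
Unset Printing Implicit Defensive.

Import GRing.Theory.
Local Open Scope ring_scope.

(* A simplicial complex with vertices in [V] is its set of faces, of type
   [{set {set V}}]; the empty set counts as a face. *)

Definition face_dim (V : finType) (sigma : {set V}) : int := #|sigma|%:Z - 1.

Definition link (V : finType) (Delta : {set {set V}}) (sigma : {set V}) :
    {set {set V}} :=
  [set tau in Delta | (tau :|: sigma \in Delta) & (tau :&: sigma == set0)].

(* Mod 2 simplicial chains of all degrees at once: a chain assigns a
   coefficient to every finite set of vertices. *)
Definition chain (V : finType) : Type := {ffun {set V} -> 'F_2}.

HB.instance Definition _ (V : finType) := GRing.Zmodule.on (chain V).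
HB.instance Definition _ (V : finType) := Finite.on (chain V).
HB.instance Definition _ (V : finType) := [finGroupMixin of chain V for +%R].

Definition chains (V : finType) (Delta : {set {set V}}) (i : nat) :
    {set chain V} :=
  [set c : chain V |
    [forall F : {set V}, (c F != 0) ==> (F \in Delta) && (#|F| == i.+1)]].

(* The linear map sending a simplex [F] to the sum of the [F :\ v], [v \in F],
   written in coordinates. The coefficient on [set0] is set to 0: homology is
   not reduced, so vertices have zero boundary. *)
Definition boundary (V : finType) (c : chain V) : chain V :=
  [ffun F : {set V} =>
    if F == set0 then 0 else \sum_(v in ~: F) c (v |: F)].

Definition cycles (V : finType) (Delta : {set {set V}}) (i : nat) :
    {set chain V} :=
  [set c in chains Delta i | boundary c == 0].

Definition boundaries (V : finType) (Delta : {set {set V}}) (i : nat) :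
    {set chain V} :=
  [set boundary c | c in chains Delta i.+1].

Lemma boundary0 (V : finType) : boundary (0 : chain V) = 0.
Proof.
apply/ffunP => F; rewrite !ffunE; case: ifP => // _.
by rewrite big1 // => v _; rewrite ffunE.
Qed.

Lemma boundaryD (V : finType) (c d : chain V) :
  boundary (c + d) = boundary c + boundary d.
Proof.
apply/ffunP => F; rewrite !ffunE; case: ifP => _; first by rewrite addr0.
by rewrite -big_split; apply: eq_bigr => v _; rewrite ffunE.
Qed.

Lemma chains0 (V : finType) (Delta : {set {set V}}) i : 0 \in chains Delta i.
Proof. by rewrite inE; apply/forallP => F; rewrite ffunE eqxx. Qed.

Lemma chainsD (V : finType) (Delta : {set {set V}}) i (c d : chain V) :
  c \in chains Delta i -> d \in chains Delta i -> c + d \in chains Delta i.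
Proof.
rewrite !inE => /forallP cP /forallP dP; apply/forallP => F.
apply/implyP; rewrite ffunE => cdF; move: (cP F) (dP F).
by have [c0|//] := eqVneq (c F) 0; move: cdF; rewrite c0 add0r => ->.
Qed.

Lemma cycles_group_set (V : finType) (Delta : {set {set V}}) i :
  group_set (cycles Delta i).
Proof.
apply/group_setP; split=> [|c d].
  by rewrite inE (chains0 Delta i) boundary0 eqxx.
rewrite inE => /andP[cC /eqP c0]; rewrite inE => /andP[dC /eqP d0].
by rewrite inE (chainsD cC dC) boundaryD c0 d0 addr0 eqxx.
Qed.
Canonical cycles_group (V : finType) (Delta : {set {set V}}) i :=
  Group (cycles_group_set Delta i).

Lemma boundaries_group_set (V : finType) (Delta : {set {set V}}) i :
  group_set (boundaries Delta i).
Proof.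
apply/group_setP; split=> [|c d].
  by apply/imsetP; exists 0; [exact: chains0 | rewrite boundary0].
move=> /imsetP[c' cC ->] /imsetP[d' dC ->]; apply/imsetP.
by exists (c' + d'); [exact: chainsD | rewrite boundaryD].
Qed.
Canonical boundaries_group (V : finType) (Delta : {set {set V}}) i :=
  Group (boundaries_group_set Delta i).

Definition homology (V : finType) (Delta : {set {set V}}) (i : nat) :=
  (cycles Delta i / boundaries Delta i)%G.

(* [sphere m] triangulates the sphere of dimension [m - 1], as the boundary of
   the simplex on [m + 1] vertices; [sphere 0], whose only face is [set0], is
   the empty sphere of dimension -1. *)
Definition sphere (m : nat) : {set {set 'I_m.+1}} :=
  [set F : {set 'I_m.+1} | F != setT].

(* Homology in every degree isomorphic to that of the [d]-sphere; in particular
   [d >= -1]. A group morphism between Z_2-vector spaces is Z_2-linear. *)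
Definition has_sphere_homology (V : finType) (Delta : {set {set V}}) (d : int) :
    Prop :=
  exists2 m : nat, d = m%:Z - 1
    & forall i : nat, homology Delta i \isog homology (sphere m) i.

(* The polygon has vertices 0, ..., 2n - 1, in cyclic order. *)
Definition vertex (n : nat) := 'I_(2 * n).
Definition segment (n : nat) := {set vertex n}.

Definition crossing (n : nat) (s t : segment n) : bool :=
  [exists a : vertex n, exists b : vertex n,
   exists c : vertex n, exists d : vertex n,
    [&& (a < b)%N, (b < c)%N, (c < d)%N
      & [|| (s == [set a; c]) && (t == [set b; d])
          | (s == [set b; d]) && (t == [set a; c])]]].

Definition has_crossing (n m : nat) (S : {set segment n}) : bool :=
  [exists X : {set segment n},
    [&& X \subset S, #|X| == m
      & [forall s in X, forall t in X, (s != t) ==> crossing s t]]].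

Definition cyclic_length (n : nat) (a b : vertex n) : nat :=
  minn `|a - b|%N (2 * n - `|a - b|)%N.

Definition Omega (n k : nat) : {set segment n} :=
  [set s : segment n | [exists a : vertex n, exists b : vertex n,
    [&& s == [set a; b], a != b & (k < cyclic_length a b)%N]]].

Lemma vertex_gt0 (n : nat) (a : vertex n) : (0 < 2 * n)%N.
Proof. exact: leq_ltn_trans (leq0n a) (ltn_ord a). Qed.

Definition rotate_vertex (n : nat) (a : vertex n) : vertex n :=
  Ordinal (ltn_pmod (a + n) (vertex_gt0 a)).

Definition rotate (n : nat) (s : segment n) : segment n :=
  [set rotate_vertex a | a in s].

(* Rotation by 180 degrees is an involution, so an orbit is {s, rotate s}. *)
Definition rotation_orbit (n : nat) (s : segment n) : {set segment n} :=
  [set s; rotate s].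

Definition orbits (n k : nat) : {set {set segment n}} :=
  [set rotation_orbit s | s in Omega n k].

Definition Dstar (n k : nat) : {set {set {set segment n}}} :=
  [set sigma : {set {set segment n}} |
    (sigma \subset orbits n k) && ~~ has_crossing k.+1 (cover sigma)].

(* Main.v *)
Require Import Defs.
From mathcomp Require Import all_boot all_order all_fingroup all_solvable all_algebra.
From mathcomp Require Import zify.

Set Implicit Arguments.
Unset Strict Implicit.
Unset Printing Implicit Defensive.

Import GRing.Theory.
Local Open Scope ring_scope.

(** The complex is a spherical subword complex of type B_(n-k). Lift the
    segments to the strip k < b - a < 2 n - k of the plane; the segment [a, b]
    becomes a comparator acting at time a + b on the positions b - a - k - 1 and
    b - a - k of a word with 2 (n - k) letters, and the half-turn becomes the
    reflection of the strip, so that orbits are generators of type B. Following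
    the partial counts of large letters through the network of the comparators
    outside a set [sigma] of orbits, one finds that they measure longest chains
    of segments of [sigma]; hence the network reverses the identity word exactly
    when [sigma] contains no (k+1)-crossing. So the faces are the sets of letters
    of a word whose complement has Demazure product w0, and a link is a complex of
    the same kind. Removing the last letter expresses such a complex through its
    link and its deletion, which are again subword complexes; by induction it is
    acyclic if the Demazure product of the word exceeds the target and is a
    homology sphere if they agree. *)

(** * Reduced mod 2 chains and vertex decompositions *)

Section ReducedChains.
Variable V : finType.
Implicit Types (Delta L D : {set {set V}}) (c d : chain V) (v : V) (F : {set V}).

Lemma addcc c : c + c = 0.
Proof. by apply/ffunP => F; rewrite !ffunE addrr_pchar2 // pchar_Fp. Qed.

Lemma addcK c d : c + (c + d) = d.
Proof. by rewrite addrA addcc add0r. Qed.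

Lemma addc_eq0 c d : (c + d == 0) = (c == d).
Proof.
apply/eqP/eqP => [cd0|->]; last exact: addcc.
by rewrite -[d](addcK c) cd0 addr0.
Qed.

(** In contrast to [boundary], the coefficient on [set0] is kept: this is the augmented complex,
    whose homology is reduced homology. *)
Definition rboundary c : chain V := [ffun F : {set V} => \sum_(v in ~: F) c (v |: F)].

Lemma rboundaryD c d : rboundary (c + d) = rboundary c + rboundary d.
Proof.
apply/ffunP => F; rewrite !ffunE -big_split.
by apply: eq_bigr => v _; rewrite ffunE.
Qed.

Lemma rboundary0 : rboundary 0 = 0.
Proof. by apply/ffunP => F; rewrite !ffunE big1 // => v _; rewrite ffunE. Qed.

(* Graded by the number of vertices of the faces, so that degree 0 is spanned
   by the empty face. *)
Definition rchain Delta j c := forall F, c F != 0 -> F \in Delta /\ #|F| = j.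

Lemma rchain0 Delta j : rchain Delta j 0.
Proof. by move=> F; rewrite ffunE eqxx. Qed.

Lemma rchainD Delta j c d : rchain Delta j c -> rchain Delta j d -> rchain Delta j (c + d).
Proof.
move=> cP dP F; rewrite ffunE.
by have [-> | /cP //] := eqVneq (c F) 0; rewrite add0r => /dP.
Qed.

Lemma rchainS L D j c : L \subset D -> rchain L j c -> rchain D j c.
Proof. by move=> sLD cP F /cP[/(subsetP sLD) FD Fj]. Qed.

Definition rcycle Delta j c := rchain Delta j c /\ rboundary c = 0.
Definition rbounds Delta j c := exists2 d, rchain Delta j.+1 d & rboundary d = c.

Lemma rbounds0 Delta j : rbounds Delta j 0.
Proof. by exists 0; [exact: rchain0 | exact: rboundary0]. Qed.

Definition acyclic Delta := forall j c, rcycle Delta j c -> rbounds Delta j c.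

(* [m] is one more than the dimension of the sphere. *)
Definition homology_sphere (m : nat) Delta :=
  [/\ set0 \in Delta,
      forall j c, j != m -> rcycle Delta j c -> rbounds Delta j c
    & exists z, [/\ rcycle Delta m z, ~ rbounds Delta m z
        & forall c, rcycle Delta m c -> rbounds Delta m c \/ rbounds Delta m (c + z)]].

(** A chain is split as c0 + v c1, where neither c0 nor c1 involves [v]: [vres] extracts c0, [vlink]
    extracts c1, and [vjoin] reassembles them. *)
Definition vres v c : chain V := [ffun F : {set V} => if v \in F then 0 else c F].
Definition vlink v c : chain V := [ffun F : {set V} => if v \in F then 0 else c (v |: F)].
Definition vjoin v c d : chain V := [ffun F : {set V} => if v \in F then d (F :\ v) else c F].

Lemma vjoinE v c : vjoin v (vres v c) (vlink v c) = c.
Proof.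
apply/ffunP => F; rewrite !ffunE; have [vF|vF] := boolP (v \in F).
  by rewrite !inE eqxx /= setD1K.
by [].
Qed.

(** Mod 2, with d for the boundary, d(c0 + v c1) = (d c0 + c1) + v d c1; this lemma and the next
    read off the two parts. *)
Lemma vlink_rboundary v c : vlink v (rboundary c) = rboundary (vlink v c).
Proof.
apply/ffunP => F; rewrite !ffunE; case: ifP => vF.
  by rewrite big1 // => u _; rewrite ffunE inE vF orbT.
rewrite [RHS](bigID (pred1 v)) /= [X in X + _]big1 ?add0r; last first.
  by move=> u /andP[_ /eqP->]; rewrite ffunE !inE eqxx.
apply: eq_big => [u|u]; first by rewrite !inE negb_or andbC.
rewrite !inE negb_or => /andP[uv uF].
by rewrite ffunE !inE vF orbF eq_sym (negbTE uv) setUCA.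
Qed.

Lemma vres_rboundary v c : vres v (rboundary c) = rboundary (vres v c) + vlink v c.
Proof.
apply/ffunP => F; rewrite !ffunE; case: ifP => vF.
  by rewrite addr0 big1 // => u _; rewrite ffunE inE vF orbT.
rewrite (bigD1 v) /= ?inE ?vF // addrC; congr (_ + _).
rewrite [RHS](bigD1 v) /= ?inE ?vF // [X in X + _]ffunE !inE eqxx /= add0r.
apply: eq_bigr => u /andP[_ uv].
by rewrite ffunE !inE vF orbF eq_sym (negbTE uv).
Qed.

Lemma chain_eq v c d : vres v c = vres v d -> vlink v c = vlink v d -> c = d.
Proof. by move=> e1 e2; rewrite -[c](vjoinE v) e1 e2 vjoinE. Qed.

Section Decomposition.
Variables (v : V) (Delta L D : {set {set V}}).
(** [L] is the link of [v] and [D] its deletion: [Delta] is [D] with a cone over [L] attached. *)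
Hypothesis DeltaE : forall F,
  (F \in Delta) = if v \in F then F :\ v \in L else F \in D.
Hypothesis L_v : forall F, F \in L -> v \notin F.
Hypothesis D_v : forall F, F \in D -> v \notin F.
Hypothesis sLD : L \subset D.

Lemma vres_rchain j c : rchain Delta j c -> rchain D j (vres v c).
Proof.
move=> cP F; rewrite ffunE; case: ifP => [_|vF /cP]; first by rewrite eqxx.
by rewrite DeltaE vF.
Qed.

Lemma vlink_rchain j c : rchain Delta j.+1 c -> rchain L j (vlink v c).
Proof.
move=> cP F; rewrite ffunE; case: ifP => [_|vF /cP]; first by rewrite eqxx.
by rewrite DeltaE setU11 setU1K ?vF // cardsU1 vF => -[? []].
Qed.

Lemma vlink_rchain0 c : rchain Delta 0 c -> vlink v c = 0.
Proof.
move=> cP; apply/ffunP => F; rewrite !ffunE; case: ifP => // vF.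
apply/eqP/negPn/negP => /cP[_ /eqP]; rewrite cards_eq0 => /eqP F0.
by have := setU11 v F; rewrite F0 inE.
Qed.

Lemma vjoin_rchain j c d :
  rchain D j.+1 c -> rchain L j d -> rchain Delta j.+1 (vjoin v c d).
Proof.
move=> cP dP F; rewrite ffunE DeltaE; case: ifP => vF; last exact: cP.
by move/dP => [FL Fj]; rewrite (cardsD1 v F) vF Fj.
Qed.

Lemma vres_join j c d : rchain D j c -> vres v (vjoin v c d) = c.
Proof.
move=> cP; apply/ffunP => F; rewrite !ffunE; case vF: (v \in F) => //.
by apply/esym/eqP/negPn/negP => /cP[/D_v]; rewrite vF.
Qed.

Lemma vlink_join j c d : rchain L j d -> vlink v (vjoin v c d) = d.
Proof.
move=> dP; apply/ffunP => F; rewrite !ffunE; case: ifP => vF.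
  by apply/esym/eqP/negPn/negP => /dP[/L_v]; rewrite vF.
by rewrite setU11 setU1K // vF.
Qed.

Lemma rcycle_parts j c : rcycle Delta j c ->
  rboundary (vres v c) = vlink v c /\ rboundary (vlink v c) = 0.
Proof.
move=> [_ c0]; rewrite -vlink_rboundary c0; split.
  apply/eqP; rewrite -addc_eq0 -vres_rboundary c0; apply/eqP/ffunP => F.
  by rewrite !ffunE if_same.
by apply/ffunP => F; rewrite !ffunE if_same.
Qed.

Lemma rbounds_parts j c e0 e1 : rchain D j.+1 e0 -> rchain L j e1 ->
  rboundary e0 + e1 = vres v c -> rboundary e1 = vlink v c -> rbounds Delta j c.
Proof.
move=> e0P e1P E0 E1; exists (vjoin v e0 e1); first exact: vjoin_rchain.
apply: (@chain_eq v).
  by rewrite vres_rboundary (vres_join _ e0P) (vlink_join _ e1P).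
by rewrite vlink_rboundary (vlink_join _ e1P).
Qed.

Lemma rcycle_link j c : rcycle Delta j.+1 c -> rcycle L j (vlink v c).
Proof.
by move=> cP; have [_ c0] := rcycle_parts cP; case: cP => /vlink_rchain.
Qed.

(** For a cycle c0 + v c1 with c1 = d e1, the chain c0 + e1 is a cycle of [D], because d c0 = c1;
    once it is d e0, the cycle is d(e0 + v e1). *)
Lemma rbounds_of_link j c :
  acyclic D -> rcycle Delta j.+1 c -> rbounds L j (vlink v c) -> rbounds Delta j.+1 c.
Proof.
move=> acD cP [e1 e1P E1]; have [r0 _] := rcycle_parts cP.
have [|e0 e0P E0] := acD j.+1 (vres v c + e1).
  split; last by rewrite rboundaryD r0 E1 addcc.
  by apply: rchainD; [apply: vres_rchain; case: cP | apply: rchainS e1P].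
by apply: rbounds_parts e0P e1P _ E1; rewrite E0 -addrA addcc addr0.
Qed.

Lemma rbounds_deg0 c : acyclic D -> rcycle Delta 0 c -> rbounds Delta 0 c.
Proof.
move=> acD cP; have l0 := vlink_rchain0 cP.1; have [r0 _] := rcycle_parts cP.
have [|e0 e0P E0] := acD 0 (vres v c).
  by split; [apply: vres_rchain; case: cP | rewrite r0].
apply: (rbounds_parts e0P (@rchain0 L 0)); first by rewrite addr0.
by rewrite l0 rboundary0.
Qed.

Lemma acyclic_decomposition : acyclic L -> acyclic D -> acyclic Delta.
Proof.
move=> acL acD [|j] c cP; first exact: rbounds_deg0.
by apply: rbounds_of_link => //; apply: acL; exact: rcycle_link.
Qed.

(** [Delta] is a cone with apex [v]; a cycle c0 + v c1 has d c0 = c1 and so is the boundary of v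
    c0. *)
Lemma acyclic_cone : L = D -> acyclic Delta.
Proof.
move=> LD j c cP; have [r0 l0] := rcycle_parts cP.
apply: (rbounds_parts (@rchain0 D j.+1) _ _ r0); last by rewrite rboundary0 add0r.
by rewrite LD; apply: vres_rchain; case: cP.
Qed.

(** [Delta] behaves as a suspension of [L]: the fundamental cycle [z] of [L] bounds some [e] in the
    acyclic [D], and e + v z is a fundamental cycle of [Delta]. *)
Lemma sphere_decomposition m :
  homology_sphere m L -> acyclic D -> homology_sphere m.+1 Delta.
Proof.
move=> [L0 acL [z [zP zB zL]]] acD; split.
- by rewrite DeltaE inE (subsetP sLD).
- move=> [|j] c jm cP; first exact: rbounds_deg0.
  by apply: rbounds_of_link => //; apply: acL => //; exact: rcycle_link.
have [|e eP E] := acD m z; first by split; [exact: rchainS zP.1 | exact: zP.2].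
have rZ := vres_join z eP; have lZ := vlink_join e zP.1.
have ZP : rcycle Delta m.+1 (vjoin v e z).
  split; first exact: vjoin_rchain eP zP.1.
  apply: (@chain_eq v); first rewrite vres_rboundary rZ lZ E addcc.
    by apply/ffunP => F; rewrite !ffunE if_same.
  rewrite vlink_rboundary lZ zP.2.
  by apply/ffunP => F; rewrite !ffunE if_same.
exists (vjoin v e z); split => // [[d dP Ed]|c cP].
  apply: zB; exists (vlink v d); first exact: vlink_rchain.
  by rewrite -vlink_rboundary Ed lZ.
have [cB|cB] := zL _ (rcycle_link cP); [left|right]; apply: rbounds_of_link => //.
  split; first by apply: rchainD; [case: cP | case: ZP].
  by rewrite rboundaryD cP.2 ZP.2 addr0.
suff -> : vlink v (c + vjoin v e z) = vlink v c + z by [].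
rewrite -[X in _ = _ + X]lZ; apply/ffunP => F; rewrite !ffunE.
by case: ifP => _; rewrite ?addr0 // ffunE.
Qed.

End Decomposition.

Lemma homology_sphere_empty : homology_sphere 0 [set set0 : {set V}].
Proof.
have noch j (c : chain V) : j != 0%N -> rchain [set set0] j c -> c = 0.
  move=> j0 cP; apply/ffunP => F; rewrite ffunE; apply/eqP/negPn/negP => /cP[].
  by rewrite inE => /eqP-> /esym/eqP; rewrite cards0 (negbTE j0).
split; first by rewrite inE.
  by move=> j c j0 [/(noch _ _ j0)-> _]; exact: rbounds0.
(* The empty face spans the reduced homology of the sphere of dimension -1. *)
pose z : chain V := [ffun F : {set V} => if F == set0 then 1 else 0].
exists z; split.
- split.
    move=> F; rewrite ffunE; have [-> _|_] := eqVneq F set0; last by rewrite eqxx.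
    by rewrite inE cards0.
  apply/ffunP => F; rewrite !ffunE big1 // => v _.
  by rewrite ffunE setU_eq0 -cards_eq0 cards1.
- move=> [d dP E]; have /ffunP/(_ set0) := E.
  by rewrite (noch _ _ _ dP) // rboundary0 !ffunE eqxx => /eqP; rewrite eq_sym oner_eq0.
move=> c [cP _]; have [c0|c0] := eqVneq (c set0) 0; [left|right].
  suff -> : c = 0 by exact: rbounds0.
  apply/ffunP => F; rewrite ffunE; apply/eqP/negPn/negP => cF.
  by have [] := cP _ cF; rewrite inE => /eqP F0; rewrite F0 c0 eqxx in cF.
suff -> : c + z = 0 by exact: rbounds0.
apply/ffunP => F; rewrite !ffunE; have [->|F0] := eqVneq F set0.
  suff -> : c set0 = 1 by rewrite addrr_pchar2 // pchar_Fp.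
  by case: (c set0) c0 => [[|[|]]] // i _; apply/val_inj.
rewrite addr0; apply/eqP/negPn/negP => /cP[]; by rewrite inE (negbTE F0).
Qed.

Lemma acyclic_simplex (B : {set V}) : B != set0 -> acyclic (powerset B).
Proof.
case/set0Pn => v vB; apply: (@acyclic_cone v _ (powerset (B :\ v)) (powerset (B :\ v))).
- move=> F; rewrite !inE; case: ifP => vF.
    apply/idP/idP => [FB|FB]; first exact: setSD.
    by rewrite -(setD1K vF) -(setD1K vB) setUS.
  by rewrite subsetD1 vF andbT.
- by move=> F; rewrite inE subsetD1 => /andP[].
- by move=> F; rewrite inE subsetD1 => /andP[].
- by [].
Qed.

(** By induction on the dimension: in the boundary of a simplex, the link of [v] is the boundary of
    the opposite facet, and the deletion is that whole facet. *)
Lemma homology_sphere_simplex_boundary (A : {set V}) m :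
  #|A| = m.+1 -> homology_sphere m (powerset A :\ A).
Proof.
elim: m A => [|m IH] A Am.
  have /cards1P[v ->] : #|A| == 1%N by rewrite Am.
  rewrite (_ : _ :\ _ = [set set0]); first exact: homology_sphere_empty.
  apply/setP => F; rewrite !inE subset1; have [->|] //= := eqVneq F [set v].
  by rewrite -cards_eq0 cards1.
have /set0Pn[v vA] : A != set0 by rewrite -cards_eq0 Am.
have Av : #|A :\ v| = m.+1 by move: Am; rewrite (cardsD1 v A) vA => -[].
apply: (@sphere_decomposition v _ (powerset (A :\ v) :\ (A :\ v)) (powerset (A :\ v))).
- move=> F; rewrite !inE; case: ifP => vF.
    congr andb; last first.
      apply/idP/idP => [FB|FB]; first exact: setSD.
      by rewrite -(setD1K vF) -(setD1K vA) setUS.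
    congr negb; apply/eqP/eqP => [->//|E].
    by rewrite -(setD1K vF) E setD1K.
  rewrite subsetD1 vF andbT; case: eqVneq => //= FA.
  by rewrite FA vA in vF.
- by move=> F; rewrite !inE subsetD1 => /and3P[].
- by move=> F; rewrite inE subsetD1 => /andP[].
- exact: subD1set.
- exact: IH.
- by apply: acyclic_simplex; rewrite -cards_eq0 Av.
Qed.

End ReducedChains.

(** * Orders of the unreduced homology groups *)

Section Cardinality.
Variables (V : finType) (Delta : {set {set V}}).
Implicit Types (c d : chain V).

Lemma chainsP i c : reflect (rchain Delta i.+1 c) (c \in chains Delta i).
Proof.
rewrite inE; apply: (iffP forallP) => [cP F cF|cP F].
  by move: (cP F); rewrite cF => /andP[-> /eqP].
by apply/implyP => /cP[-> ->]; rewrite eqxx.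
Qed.

Lemma boundary_rchain i c : rchain Delta i.+2 c -> boundary c = rboundary c.
Proof.
move=> cP; apply/ffunP => F; rewrite !ffunE; case: eqP => // ->.
rewrite big1 // => v _; apply/eqP/negPn/negP => /cP[_].
by rewrite setU0 cards1.
Qed.

Lemma rboundary_rchain1 c : rchain Delta 1 c ->
  boundary c = 0 /\ (forall F, F != set0 -> rboundary c F = 0).
Proof.
move=> cP.
have c0 (F : {set V}) : F != set0 -> \sum_(v in ~: F) c (v |: F) = 0.
  move=> F0; rewrite big1 // => v; rewrite inE => vF; apply/eqP/negPn/negP => /cP[_].
  by rewrite cardsU1 vF => -[/eqP]; rewrite cards_eq0 (negbTE F0).
split; last by move=> F F0; rewrite ffunE c0.
by apply/ffunP => F; rewrite !ffunE; case: eqVneq => // /c0.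
Qed.

Lemma boundariesP i c : reflect (rbounds Delta i.+1 c) (c \in boundaries Delta i).
Proof.
apply: (iffP imsetP) => [[d /chainsP dP ->]|[d dP <-]]; exists d => //.
- by rewrite (boundary_rchain dP).
- exact/chainsP.
- by rewrite (boundary_rchain dP).
Qed.

Lemma rchain_set0 c : rchain Delta 1 c -> (rboundary c == 0) = (rboundary c set0 == 0).
Proof.
move=> cP; apply/eqP/eqP => [->|c0]; first by rewrite ffunE.
apply/ffunP => G; rewrite [RHS]ffunE; have [->//|/(rboundary_rchain1 cP).2] := eqVneq G set0.
by [].
Qed.

(** The ordered pairs (u, w) and (w, u) contribute the same coefficient and cancel mod 2;
    [enum_rank] serves to pick one of the two. *)
Lemma rboundaryK j c : rchain Delta j.+1 c -> rboundary (rboundary c) = 0.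
Proof.
move=> cP; apply/ffunP => F; rewrite !ffunE.
under eq_bigr => u uF do rewrite ffunE.
rewrite pair_big_dep /=.
pose sw (p : V * V) := (p.2, p.1).
pose Pr (p : V * V) := [&& p.1 \notin F, p.2 \notin F & p.1 != p.2].
rewrite (eq_bigl Pr); last first.
  move=> [u w]; rewrite /Pr !inE /= negb_or (eq_sym w u).
  by case: (u \in F); case: (w \in F); case: (u == w).
rewrite (bigID (fun p : V * V => (enum_rank p.1 < enum_rank p.2)%N)) /=.
rewrite [X in _ + X](reindex_inj (h := sw)) /=; last by move=> [? ?] [? ?] [-> ->].
rewrite [X in _ + X](eq_big (fun p : V * V => Pr p && (enum_rank p.1 < enum_rank p.2)%N)
    (fun p : V * V => c (p.2 |: (p.1 |: F)))).
- by rewrite addrr_pchar2 // pchar_Fp.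
- move=> [u w]; rewrite /Pr /=.
  have -> : ~~ (enum_rank w < enum_rank u)%N = (enum_rank u <= enum_rank w)%N.
    by rewrite -leqNgt.
  rewrite leq_eqVlt (inj_eq val_inj) (inj_eq enum_rank_inj) (eq_sym w u).
  by case: (u \in F); case: (w \in F); case: (u == w); rewrite ?andbF.
- by move=> [u w] _ /=; rewrite setUCA.
Qed.

(** Degree 0 carries no boundary condition, as vertices have zero unreduced boundary. *)
Lemma cyclesP i c : reflect (rchain Delta i.+1 c /\ (i != 0%N -> rboundary c = 0))
  (c \in cycles Delta i).
Proof.
rewrite [_ \in cycles _ _]inE; apply: (iffP andP) => [[/chainsP cP /eqP c0]|[cP c0]].
  split=> //; case: i cP => // i cP _; by rewrite -(boundary_rchain cP).
split; first exact/chainsP.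
case: i cP c0 => [|i] cP c0; first by rewrite (rboundary_rchain1 cP).1.
by rewrite (boundary_rchain cP) c0.
Qed.

(** [G] is the disjoint union of [H] and its translate by [e]. *)
Lemma card_double (G H : {set chain V}) e :
    H \subset G -> (forall c d, c \in H -> d \in H -> c + d \in H) ->
    (forall c, c \in G -> c + e \in G) -> e \notin H ->
    (forall c, c \in G -> c \in H \/ c + e \in H) ->
  #|G| = (2 * #|H|)%N.
Proof.
move=> sHG HD Ge eH GP; pose He := [set c + e | c in H].
have -> : G = H :|: He.
  apply/setP => c; rewrite inE; apply/idP/orP => [/GP[]|[/(subsetP sHG)//|/imsetP[d dH ->]]].
  - by left.
  - move=> ceH; right; apply/imsetP; exists (c + e) => //.
    by rewrite -addrA addcc addr0.
  - exact/Ge/(subsetP sHG).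
have -> : #|H :|: He| = (#|H| + #|He|)%N.
  rewrite cardsU (_ : H :&: He = set0) ?cards0 ?subn0 //.
  apply/setP => c; rewrite !inE; apply/negP => /andP[cH /imsetP[d dH E]].
  by case/negP: eH; rewrite -[e](addcK d) -E HD.
by rewrite card_imset ?mul2n ?addnn // => c d /addIr.
Qed.

Lemma F2_neq0 (x : 'F_2) : x != 0 -> x = 1.
Proof. by case: x => [[|[|]]] // i _; apply/val_inj. Qed.

Lemma cycles_meet_boundariesD i c d :
  c \in cycles Delta i :&: boundaries Delta i ->
  d \in cycles Delta i :&: boundaries Delta i ->
  c + d \in cycles Delta i :&: boundaries Delta i.
Proof. exact: (@groupM _ [group of cycles Delta i :&: boundaries Delta i]). Qed.

Lemma abelem_chain : (2.-abelem [set: chain V])%g.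
Proof.
apply/abelemP => //; split; last by move=> c _; exact: addcc.
by apply/centsP => c _ d _; exact: addrC.
Qed.

Lemma card_homology_quotient i r :
  #|cycles Delta i| = (r * #|cycles Delta i :&: boundaries Delta i|)%N ->
  #|homology Delta i| = r.
Proof.
move=> E; rewrite /homology /= card_quotient; last first.
  apply/cents_norm/(sub_abelian_cent2 (abelem_abelian abelem_chain)); exact: subsetT.
rewrite -indexgI.
have /eqP := Lagrange (subsetIl (cycles_group Delta i) (boundaries_group Delta i)).
rewrite /= E mulnC eqn_pmul2r ?cardG_gt0 // => /eqP //.
Qed.

(** The first factor is reduced homology. The second is the passage to unreduced homology in degree
    0, which doubles the cycles when the complex has a vertex, that is, when m > 0. *)
Lemma card_homology_sphere m i : homology_sphere m Delta ->
  #|homology Delta i| =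
    ((if i.+1 == m then 2 else 1) * (if (i == 0) && (0 < m) then 2 else 1))%N.
Proof.
move=> [Delta0 acD [z [zP zB zL]]].
pose Z := [set c in cycles Delta i | rboundary c == 0].
have ZP c : reflect (rcycle Delta i.+1 c) (c \in Z).
  rewrite inE; apply: (iffP andP) => [[/cyclesP[cP _] /eqP]|[cP c0]] //.
  by split; [apply/cyclesP | rewrite c0].
have CB : cycles Delta i :&: boundaries Delta i = Z :&: boundaries Delta i.
  apply/setP => c; rewrite !in_setI [c \in Z]inE -andbA; congr andb.
  by case: (boundariesP i c) => [[d dP <-]|_]; rewrite ?andbF // (rboundaryK dP) eqxx.
have ZB : #|Z| = ((if i.+1 == m then 2 else 1) * #|Z :&: boundaries Delta i|)%N.
  case: eqP => [im|/eqP im]; last first.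
    rewrite mul1n; congr #|pred_of_set _|; apply/esym/setIidPl/subsetP => c /ZP cP.
    exact/boundariesP/acD.
  apply: (@card_double _ _ z); first exact: subsetIl.
  - by rewrite -CB; exact: cycles_meet_boundariesD.
  - move=> c /ZP[cP c0]; apply/ZP; rewrite im; split.
      by apply: rchainD zP.1; rewrite -im.
    by rewrite rboundaryD c0 zP.2 addr0.
  - by rewrite inE negb_and; apply/orP; right; apply/boundariesP; rewrite im.
  move=> c cZ; have /ZP cP := cZ; rewrite im in cP.
  have [cB|cB] := zL _ cP; [left|right]; rewrite inE.
    by rewrite cZ; apply/boundariesP; rewrite im.
  apply/andP; split; last by apply/boundariesP; rewrite im.
  apply/ZP; rewrite im; split; first exact: rchainD cP.1 zP.1.
  by rewrite rboundaryD cP.2 zP.2 addr0.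
apply: card_homology_quotient; rewrite CB mulnAC -ZB.
case: (posnP i) => [i0|i0] /=; last first.
  rewrite ?muln1; congr #|pred_of_set _|; apply/setP => c; rewrite [RHS]inE.
  case: (cyclesP i c) => [[_ c0]|_] //; rewrite c0 ?eqxx //.
  by rewrite -lt0n.
case: (posnP m) => m0 /=.
  rewrite muln1; congr #|pred_of_set _|; apply/setP => c; rewrite [RHS]inE i0.
  case: (cyclesP 0 c) => [[cP _]|_] //; suff -> : c = 0 by rewrite rboundary0 eqxx.
  (* For m = 0 the empty face is not a boundary, so there is no vertex [F]: its reduced boundary
     would be [z]. *)
  apply/ffunP => F; rewrite ffunE; apply/eqP/negPn/negP => /cP[FD F1].
  case: (zB); rewrite m0; exists [ffun G => if G == F then 1 else 0].
    by move=> G; rewrite ffunE; case: (G =P F) => [->//|]; rewrite eqxx.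
  have /cards1P[v Fv] : #|F| == 1%N by rewrite F1.
  have z0 : z set0 = 1.
    apply: F2_neq0; apply/negP => /eqP z0; case: zB.
    suff -> : z = 0 by exact: rbounds0.
    apply/ffunP => G; rewrite ffunE; apply/eqP/negPn/negP => zG.
    have [_ /eqP] := zP.1 _ zG; rewrite m0 cards_eq0 => /eqP G0.
    by rewrite G0 z0 eqxx in zG.
  apply/ffunP => G; rewrite ffunE; have [->|G0] := eqVneq G set0.
    rewrite z0 (bigD1 v) ?inE //= ffunE setU0 Fv eqxx big1 ?addr0 // => u /andP[_ uv].
    by rewrite ffunE setU0; case: eqP => // /set1_inj E; rewrite E eqxx in uv.
  transitivity (0 : 'F_2).
    rewrite big1 // => u; rewrite inE => uG; rewrite ffunE; case: eqP => // E.
    move: F1; rewrite -E cardsU1 uG => -[] /eqP; by rewrite cards_eq0 (negbTE G0).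
  apply/esym/eqP/negPn/negP => /(zP.1 _)[_ /eqP]; rewrite m0 cards_eq0.
  by rewrite (negbTE G0).
(* For m > 0 the empty face bounds a 0-chain [e], which has an odd number of vertices; adding [e]
   exchanges the even and the odd 0-chains. *)
have [||e eP E] := acD 0 [ffun F => if F == set0 then 1 else 0].
- by rewrite eq_sym -lt0n.
- split; first move=> F; rewrite ?ffunE.
    by case: (F =P set0) => [-> _|_]; rewrite ?cards0 ?eqxx.
  apply/ffunP => F; rewrite !ffunE big1 // => v _.
  by rewrite ffunE setU_eq0 -cards_eq0 cards1.
have e0 : rboundary e set0 = 1 by rewrite E ffunE eqxx.
rewrite mulnC; apply: (@card_double _ _ e).
- by apply/subsetP => c; rewrite inE => /andP[].
- move=> c d /ZP[cP c0] /ZP[dP d0]; apply/ZP; split; first exact: rchainD.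
  by rewrite rboundaryD c0 d0 addr0.
- by move=> c /cyclesP[cP _]; apply/cyclesP; split; [apply: rchainD => //; rewrite i0 | rewrite i0].
- apply/ZP => -[_ e1]; move: e0; rewrite e1 ffunE => /eqP.
  by rewrite eq_sym oner_eq0.
move=> c cC; have /cyclesP[cP _] := cC; rewrite i0 in cP.
have [c0|c0] := eqVneq (rboundary c set0) 0; [left|right]; apply/ZP; rewrite i0.
  by split=> //; apply/eqP; rewrite rchain_set0 // c0.
split; first exact: rchainD.
apply/eqP; rewrite rchain_set0; last exact: rchainD.
by rewrite rboundaryD ffunE e0 (F2_neq0 c0) addrr_pchar2 // pchar_Fp.
Qed.

End Cardinality.

Lemma homology_sphere_std m : homology_sphere m (sphere m).
Proof.
have -> : sphere m = powerset [set: 'I_m.+1] :\ [set: 'I_m.+1].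
  by apply/setP => F; rewrite !inE subsetT andbT.
by apply: homology_sphere_simplex_boundary; rewrite cardsT card_ord.
Qed.

(** The homology groups are elementary abelian 2-groups, so equal orders make them isomorphic. *)
Lemma has_sphere_homologyP (V : finType) (Delta : {set {set V}}) m :
  homology_sphere m Delta -> has_sphere_homology Delta (m%:Z - 1).
Proof.
move=> sD; exists m => // i.
have abH (U : finType) (K : {set {set U}}) : (2.-abelem (homology K i))%g.
  apply: quotient_abelem; apply: abelemS (abelem_chain U); exact: subsetT.
rewrite (isog_abelem_card _ (abH _ Delta)) abH /=.
by rewrite (card_homology_sphere _ sD) (card_homology_sphere _ (homology_sphere_std m)).
Qed.

Local Open Scope nat_scope.

(** * Subword complexes *)

Section Subword.
Variables (V : finType) (S W : Type).
(** An axiomatic Coxeter group with Bruhat order: [up s] and [dn s] multiply by a generator when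
    that raises, respectively lowers, the element. The adjunction [up_dn] is the lifting property.
    Elements will be functions compared on a finite range, so [le] is a preorder; [len] is twice the
    length. *)
Variables (le : rel W) (wf : W -> Prop) (letter : pred S).
Variables (up dn : S -> W -> W) (bot : W) (len : W -> nat).
Hypothesis le_refl : reflexive le.
Hypothesis le_trans : transitive le.
Hypothesis wf_up : forall s x, letter s -> wf x -> wf (up s x).
Hypothesis wf_dn : forall s x, letter s -> wf x -> wf (dn s x).
Hypothesis wf_bot : wf bot.
Hypothesis up_dn : forall s x y, letter s -> wf x -> wf y -> le x (up s y) = le (dn s x) y.
Hypothesis le_up : forall s x, letter s -> wf x -> le x (up s x).
Hypothesis up_idem : forall s x, letter s -> wf x -> le (up s (up s x)) (up s x).
Hypothesis dn_or_up : forall s x, letter s -> wf x -> le x (dn s x) \/ le (up s x) x.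
Hypothesis up_not_dn : forall s x, letter s -> wf x -> ~~ le (up s x) (dn s x).
Hypothesis bot_min : forall x, wf x -> le x bot -> le bot x /\ len x = 0.
Hypothesis len_dn : forall s x, letter s -> wf x -> ~~ le x (dn s x) ->
  len x = (len (dn s x)).+2.

Implicit Types (Q : seq (V * S)) (F G : {set V}) (x y : W).

(* The Demazure product of the letters of [Q] outside [F]; the head of [Q] acts last. *)
Definition demazure Q F : W :=
  foldr (fun p y => if p.1 \in F then y else up p.2 y) bot Q.

Definition subword Q x : {set {set V}} :=
  [set F : {set V} | (F \subset [set:: unzip1 Q]) && le x (demazure Q F)].

Let letters Q := all (fun p => letter p.2) Q.

Lemma wf_demazure Q F : letters Q -> wf (demazure Q F).
Proof.
elim: Q => //= -[v s] Q IH /= /andP[ls lQ]; case: ifP => _; first exact: IH.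
by apply: wf_up => //; exact: IH.
Qed.

Lemma dn_le s x : letter s -> wf x -> le (dn s x) x.
Proof. by move=> ls wx; rewrite -up_dn // le_up. Qed.

Lemma up_mono s x y : letter s -> wf x -> wf y -> le x y -> le (up s x) (up s y).
Proof.
move=> ls wx wy xy; rewrite up_dn //; last exact: wf_up.
by apply: le_trans xy; rewrite -up_dn //; exact: wf_up.
Qed.

Lemma demazure_mono Q F G : letters Q -> F \subset G -> le (demazure Q G) (demazure Q F).
Proof.
move=> lQ sFG; elim: Q lQ => [|[v s] Q IH] /=; first by rewrite le_refl.
move=> /andP[ls lQ]; have := IH lQ; have wF := wf_demazure F lQ.
have wG := wf_demazure G lQ => GF; case: (boolP (v \in F)) => vF.
  by rewrite (subsetP sFG _ vF).
case: ifP => _; first exact: le_trans (le_up _ _).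
exact: up_mono.
Qed.

Lemma demazure_eq Q F G :
  (forall v, v \in unzip1 Q -> (v \in F) = (v \in G)) -> demazure Q F = demazure Q G.
Proof.
elim: Q => //= -[v s] Q IH /= FG; rewrite FG ?mem_head // IH // => u uQ.
by rewrite FG // inE uQ orbT.
Qed.

Lemma demazure_filter Q F G :
  demazure [seq p <- Q | p.1 \notin G] F = demazure Q (F :|: G).
Proof.
elim: Q => //= -[v s] Q IH /=; rewrite inE; case: (v \in G) => /=.
  by rewrite orbT.
by rewrite orbF IH.
Qed.

Lemma subword_closed Q x F G : letters Q -> F \subset G ->
  G \in subword Q x -> F \in subword Q x.
Proof.
move=> lQ sFG; rewrite !inE => /andP[GQ xG]; rewrite (subset_trans sFG GQ).
exact: le_trans (demazure_mono lQ sFG).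
Qed.

Lemma link_subword Q x G : letters Q -> G \in subword Q x ->
  link (subword Q x) G = subword [seq p <- Q | p.1 \notin G] x.
Proof.
move=> lQ GQ; apply/setP => F; rewrite inE.
have E : unzip1 [seq p <- Q | p.1 \notin G] = [seq v <- unzip1 Q | v \notin G].
  by rewrite /unzip1 filter_map.
have -> : (F :&: G == set0) = (F \subset ~: G).
  by rewrite setI_eq0 disjoints_subset.
apply/and3P/idP => [[FQ]|].
  rewrite inE subUset => /andP[/andP[sF sG] xFG] FG; rewrite inE E demazure_filter.
  rewrite xFG andbT; apply/subsetP => v vF; rewrite inE mem_filter.
  by have := subsetP sF _ vF; have := subsetP FG _ vF; rewrite !inE => -> ->.
rewrite inE E => /andP[/subsetP FQ]; rewrite demazure_filter.
move=> xFG.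
have FGQ : F :|: G \in subword Q x.
  rewrite inE xFG andbT subUset; apply/andP; split.
    by apply/subsetP => v /FQ; rewrite !inE mem_filter => /andP[].
  by move: GQ; rewrite inE => /andP[].
split=> //; first exact: subword_closed (subsetUl F G) FGQ.
by apply/subsetP => v /FQ; rewrite !inE mem_filter => /andP[].
Qed.

(* A subword complex decomposes at its last acting letter [s] into the link, a
   subword complex for the same [x], and the deletion, one for [dn s x]. *)
Lemma subword_homology Q x : letters Q -> uniq (unzip1 Q) -> wf x ->
    le x (demazure Q set0) ->
  (le (demazure Q set0) x ->
     exists2 d, 2 * d + len x = 2 * size Q & homology_sphere d (subword Q x)) /\
  (~~ le (demazure Q set0) x -> acyclic (subword Q x)).
Proof.
elim: Q x => [|[v s] Q IH] x /=.
  move=> _ _ wx xb; have [bx l0] := bot_min wx xb; rewrite bx; split=> // _.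
  exists 0; first by rewrite l0.
  rewrite (_ : subword _ _ = [set set0]); first exact: homology_sphere_empty.
  apply/setP => F; rewrite !inE /= xb andbT -subset0.
  by rewrite (_ : [set:: [::]] = set0) //; apply/setP => v; rewrite !inE.
move=> /andP[ls lQ] /andP[vQ uQ] wx; rewrite inE /=.
set y := demazure Q set0 => xy.
have wy : wf y by exact: wf_demazure.
have wdx := wf_dn ls wx; have wux := wf_up ls wx.
have notv x' F : F \in subword Q x' -> v \notin F.
  rewrite inE => /andP[/subsetP FQ _]; apply/negP => /FQ; rewrite inE.
  by rewrite (negbTE vQ).
(* In a face that avoids [v] the head letter acts, and [up_dn] moves it over to the target. *)
have decomp F : (F \in subword ((v, s) :: Q) x) =
    if v \in F then F :\ v \in subword Q x else F \in subword Q (dn s x).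
  rewrite [LHS]inE /= set_cons; case: ifP => vF.
    rewrite inE; congr andb.
      by rewrite subDset.
    congr (le _ _); apply: demazure_eq => u uQ'; rewrite !inE.
    by have [E|//] := eqVneq u v; rewrite E (negbTE vQ) in uQ'.
  rewrite inE; congr andb; last by rewrite up_dn //; exact: wf_demazure.
  apply/subsetP/subsetP => FQ u uF; last by rewrite inE FQ ?orbT.
  by have := FQ u uF; rewrite !inE => /predU1P[E|//]; rewrite -E uF in vF.
have sub : subword Q x \subset subword Q (dn s x).
  apply/subsetP => F; rewrite !inE => /andP[-> xF] /=.
  by apply: le_trans xF; exact: dn_le.
have dxy : le (dn s x) y by rewrite -up_dn.
(* If the rest of the word does not reach [x], no face contains [v], and the complex equals its
   deletion. *)
have void : ~~ le x y -> subword ((v, s) :: Q) x = subword Q (dn s x).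
  move=> nxy; apply/setP => F; rewrite decomp; case: ifP => // vF.
  have -> : (F \in subword Q (dn s x)) = false.
    by apply/negP => /notv; rewrite vF.
  apply/negP; rewrite inE => /andP[_ xF]; case/negP: nxy.
  by apply: le_trans xF _; apply: demazure_mono => //; exact: sub0set.
(* When [s] is not a descent of [x], link and deletion agree and the complex is a cone. The product
   cannot equal [x] here, or [up s x] would lie below [dn s x]. *)
have [xd|nxd] := boolP (le x (dn s x)).
  split=> [yx|_].
    case/negP: (up_not_dn ls wx); apply: le_trans xd.
    apply: le_trans (_ : le (up s (up s y)) _); last exact: le_trans (up_idem ls wy) yx.
    by apply: up_mono => //; exact: wf_up.
  apply: (@acyclic_cone _ v _ (subword Q x) (subword Q (dn s x)) decomp).
  - exact: notv.
  - exact: notv.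
  apply/eqP; rewrite eqEsubset sub /=; apply/subsetP => F; rewrite !inE.
  by case/andP=> -> dF; exact: le_trans dF.
have ux : le (up s x) x.
  by have [xd|//] := dn_or_up ls wx; rewrite xd in nxd.
have [sphd acd] := IH _ lQ uQ wdx dxy.
have uyx : le y x -> le (up s y) x.
  by move=> yx; apply: le_trans ux; exact: up_mono.
split=> [yx|nyx].
  (* The product equals [x]. Either [y] equals [x] already, with a sphere as link and an acyclic
     deletion, or [y] equals [dn s x] and the complex is its deletion, a sphere. *)
  have [xy'|nxy] := boolP (le x y).
    have nyd : ~~ le y (dn s x) by apply: contra nxd; exact: le_trans.
    have yx' : le y x by apply: le_trans yx; exact: le_up.
    have [d dE sph] := (IH _ lQ uQ wx xy').1 yx'.
    exists d.+1; first by rewrite !mulnS -addnA dE.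
    exact: (sphere_decomposition decomp (@notv _) (@notv _) sub sph (acd nyd)).
  have yd : le y (dn s x).
    have [yd|uy] := dn_or_up ls wy; last first.
      by case/negP: nxy; exact: le_trans uy.
    apply: le_trans yd _; rewrite -up_dn //.
    apply: le_trans (_ : le x _); first by apply: le_trans yx; exact: le_up.
    by rewrite up_dn.
  have [d dE sph] := sphd yd; exists d; last by rewrite void.
  by rewrite (len_dn ls wx nxd) mulnS -dE !addnS.
(* The product exceeds [x], hence [y] exceeds [dn s x] and the deletion is acyclic; the link is
   acyclic or has no face at all. *)
have nyd : ~~ le y (dn s x).
  apply: contra nyx => yd; apply: uyx; exact: le_trans (dn_le ls wx).
have [xy'|nxy] := boolP (le x y); last by rewrite void //; exact: acd.
apply: (acyclic_decomposition decomp (@notv _) (@notv _) sub _ (acd nyd)).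
apply: (IH _ lQ uQ wx xy').2; apply: contra nyx; exact: uyx.
Qed.

End Subword.

(** * The Coxeter group of type B *)

Section SignedPermutations.
Variable m : nat.
Local Notation M := (2 * m).
Implicit Types (x y : nat -> nat) (p q i j l r : nat).

Fixpoint height x q i := if i is i'.+1 then height x q i' + (q <= x i') else 0.

Lemma height_eq x y q i : (forall p, p < i -> x p = y p) -> height x q i = height y q i.
Proof.
elim: i => //= i IH xy; rewrite xy // IH // => p pi; apply: xy; exact: leqW.
Qed.

Lemma height_mono x q i : height x q i <= height x q i.+1.
Proof. by rewrite /= leq_addr. Qed.

Lemma height_lip x q i : height x q i.+1 <= (height x q i).+1.
Proof. by rewrite /=; case: (q <= x i); lia. Qed.

Lemma height_monoD x q i d : height x q i <= height x q (i + d).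
Proof.
elim: d => [|d IH]; rewrite ?addn0 // addnS; exact: leq_trans IH (height_mono _ _ _).
Qed.

Lemma height_lipD x q i d : height x q (i + d) <= height x q i + d.
Proof.
elim: d => [|d IH]; rewrite ?addn0 // addnS; have := height_lip x q (i + d); lia.
Qed.

(* Elements of the Coxeter group of type B_m, as permutations of [0, M) that
   commute with the reflection p |-> M - 1 - p. *)
Definition signed x :=
  (forall p, p < M -> x p + x (M.-1 - p) = M.-1) /\
  (forall p r, p < M -> r < M -> x p = x r -> p = r).

(** The rank criterion for the Bruhat order of the symmetric group, whose restriction to signed
    permutations is the Bruhat order of type B. *)
Definition bruhat x y :=
  all (fun q => all (fun i => height x q i <= height y q i) (iota 0 M.+1)) (iota 0 M.+1).

Lemma bruhatP x y : reflect
  (forall q i, q <= M -> i <= M -> height x q i <= height y q i) (bruhat x y).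
Proof.
apply: (iffP allP) => [H q i qM iM|H q].
  have /H/allP : q \in iota 0 M.+1 by rewrite mem_iota.
  by apply; rewrite mem_iota.
rewrite mem_iota => /andP[_ qM]; apply/allP => i; rewrite mem_iota => /andP[_ iM].
exact: H.
Qed.

Lemma bruhat_refl : reflexive bruhat.
Proof. by move=> x; apply/bruhatP. Qed.

Lemma bruhat_trans : transitive bruhat.
Proof.
move=> y x z /bruhatP xy /bruhatP yz; apply/bruhatP => q i qM iM.
exact: leq_trans (xy _ _ qM iM) (yz _ _ qM iM).
Qed.

Definition sletter l := 0 < l < M.
Definition moved l j := (j == l) || (j == M - l).

(* The generator exchanges the positions l - 1, l and M - l - 1, M - l; these
   are the same two positions when l = m. *)
Definition swap l p :=
  if moved l p.+1 then p.+1 else if moved l p then p.-1 else p.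

Definition sup l x := if x l.-1 < x l then x \o swap l else x.
Definition sdn l x := if x l < x l.-1 then x \o swap l else x.

Lemma movedS l j : sletter l -> moved l j -> [/\ 0 < j, j < M, ~~ moved l j.-1 & ~~ moved l j.+1].
Proof. by rewrite /sletter /moved => lM mj; split; lia. Qed.

Lemma height_swap l x q j : sletter l ->
  height (x \o swap l) q j = if moved l j then height x q j.-1 + (q <= x j) else height x q j.
Proof.
move=> lM; elim: j => [|j IH] /=.
  by rewrite /moved; case: ifP => //; move: lM; rewrite /sletter; lia.
rewrite IH /swap; case: (boolP (moved l j.+1)) => mS.
  by have [_ _ /= /negbTE-> _] := movedS lM mS.
case: ifP => // mj; have [j0 _ _ _] := movedS lM mj.
by case: j j0 {IH mS mj} => //= j _; lia.
Qed.

Lemma signed_swap l x : sletter l -> signed x -> signed (x \o swap l).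
Proof.
move=> lM [sx ix].
have sM p : p < M -> swap l p < M.
  by move: lM; rewrite /swap /moved /sletter; do ?case: ifP; lia.
have sK p : p < M -> swap l (swap l p) = p.
  move: lM; rewrite {2}/swap /moved /sletter.
  by case: ifP; last case: ifP; rewrite /swap /moved; do ?case: ifP; lia.
split=> [p pM|p r pM rM /= /ix E] /=.
  have -> : swap l (M.-1 - p) = M.-1 - swap l p.
    by move: lM; rewrite /swap /moved /sletter; do ?case: ifP; lia.
  exact/sx/sM.
by rewrite -(sK p) // E ?sK // sM.
Qed.

Lemma signed_sup l x : sletter l -> signed x -> signed (sup l x).
Proof. by move=> lM wx; rewrite /sup; case: ifP => // _; exact: signed_swap. Qed.

Lemma signed_sdn l x : sletter l -> signed x -> signed (sdn l x).
Proof. by move=> lM wx; rewrite /sdn; case: ifP => // _; exact: signed_swap. Qed.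

(** The reflection reverses positions and values, so the mirrored pair is ordered like the pair
    tested in [sup] and [sdn]. *)
Lemma moved_lt l x j : sletter l -> signed x -> moved l j ->
  (x j.-1 < x j) = (x l.-1 < x l) /\ (x j < x j.-1) = (x l < x l.-1).
Proof.
move=> lM [sx ix] /orP[/eqP->//|/eqP->].
move: lM; rewrite /sletter => lM.
have E1 := sx l.-1; have E2 := sx l.
have F1 : M.-1 - l.-1 = M - l by lia.
have F2 : M.-1 - l = (M - l).-1 by lia.
rewrite F1 in E1; rewrite F2 in E2; lia.
Qed.

(** With the larger value in front, row [j] exceeds row [j - 1] as soon as either value counts,
    hence the minimum. This is the local rule of the network. *)
Lemma height_sup l x q j : sletter l -> signed x ->
  height (sup l x) q j =
    if moved l j then minn (height x q j.-1).+1 (height x q j.+1) else height x q j.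
Proof.
move=> lM wx; have E : (if x l.-1 < x l then height (x \o swap l) q j else height x q j)
    = height (sup l x) q j by rewrite /sup; case: ifP.
rewrite -E height_swap //; case: (boolP (moved l j)) => mj; last by rewrite if_same.
have [E1 _] := moved_lt lM wx mj; rewrite -E1; have [j0 _ _ _] := movedS lM mj.
case: j j0 {mj E E1} => //= j _; case: ifP; lia.
Qed.

Lemma height_sdn l x q j : sletter l -> signed x ->
  height (sdn l x) q j =
    if moved l j then maxn (height x q j.-1) (height x q j.+1).-1 else height x q j.
Proof.
move=> lM wx; have E : (if x l < x l.-1 then height (x \o swap l) q j else height x q j)
    = height (sdn l x) q j by rewrite /sdn; case: ifP.
rewrite -E height_swap //; case: (boolP (moved l j)) => mj; last by rewrite if_same.
have [_ E1] := moved_lt lM wx mj; rewrite -E1; have [j0 jM _ _] := movedS lM mj.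
have neq : x j <> x j.-1 by move=> /wx.2; lia.
case: j j0 neq {mj jM E E1} => //= j _; case: ifP; lia.
Qed.

(* Both sides say that x <= y holds in all rows of heights not moved by l. *)
Lemma sup_sdn l x y : sletter l -> signed x -> signed y ->
  bruhat x (sup l y) = bruhat (sdn l x) y.
Proof.
move=> lM wx wy; apply/bruhatP/bruhatP => H q j qM jM.
  rewrite height_sdn //; case: ifP => mj; last first.
    by have := H q j qM jM; rewrite height_sup // mj.
  have [j0 jM' n1 n2] := movedS lM mj.
  have := H q j.-1 qM; have := H q j.+1 qM.
  rewrite !height_sup // (negbTE n1) (negbTE n2).
  have := height_lip y q j; have := height_mono y q j.-1.
  rewrite prednK //; lia.
rewrite height_sup //; case: ifP => mj; last first.
  by have := H q j qM jM; rewrite height_sdn // mj.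
have [j0 jM' n1 n2] := movedS lM mj.
have := H q j.-1 qM; have := H q j.+1 qM.
rewrite !height_sdn // (negbTE n1) (negbTE n2).
have := height_lip x q j.-1; have := height_mono x q j.
rewrite prednK //; lia.
Qed.

Lemma bruhat_sup l x : sletter l -> signed x -> bruhat x (sup l x).
Proof.
move=> lM wx; apply/bruhatP => q j _ _; rewrite height_sup //; case: ifP => // mj.
have [j0 _ _ _] := movedS lM mj.
by have := height_lip x q j.-1; have := height_mono x q j; rewrite prednK //; lia.
Qed.

Lemma sup_idem l x : sletter l -> signed x -> bruhat (sup l (sup l x)) (sup l x).
Proof.
move=> lM wx; have wu := signed_sup lM wx; apply/bruhatP => q j _ _.
rewrite height_sup // !(height_sup _ _ lM wx); case: (boolP (moved l j)) => // mj.
by have [_ _ /negbTE-> /negbTE->] := movedS lM mj.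
Qed.

Lemma sdn_or_sup l x : sletter l -> signed x -> bruhat x (sdn l x) \/ bruhat (sup l x) x.
Proof.
move=> _ _; case: (ltnP (x l.-1) (x l)) => h; [left|right].
  by rewrite /sdn ltnNge (ltnW h) bruhat_refl.
by rewrite /sup ltnNge h bruhat_refl.
Qed.

Lemma sup_not_sdn l x : sletter l -> signed x -> ~~ bruhat (sup l x) (sdn l x).
Proof.
(* For [q] the larger of the two values, row [l] counts it in [sup l x] but not in [sdn l x]. *)
move=> lM wx; apply/negP => /bruhatP /(_ (maxn (x l.-1) (x l)) l).
have ml : moved l l by rewrite /moved eqxx.
rewrite height_sup // height_sdn // ml.
move: (lM); rewrite /sletter => lM'; have neq : x l.-1 <> x l by move=> /wx.2; lia.
have := wx.1 l.-1; have := wx.1 l; case: l lM lM' ml neq => //= l lM lM' ml neq; lia.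
Qed.

Lemma bruhat_ext x y : (forall p, p < M -> x p = y p) -> bruhat x y.
Proof.
move=> xy; apply/bruhatP => q i qM iM; rewrite (@height_eq x y) // => p pi.
by apply: xy; lia.
Qed.

Lemma height_id q i : height id q i = i - q.
Proof. by elim: i => //= i ->; lia. Qed.

Lemma signed_id : signed id.
Proof. by split=> *; lia. Qed.

Definition srev p := M.-1 - p.

Lemma signed_srev : signed srev.
Proof. by rewrite /srev; split=> *; lia. Qed.

Lemma height_srev q i : i <= M -> height srev q i = minn i (M - q).
Proof. by elim: i => [|i IH] iM /=; [|rewrite IH /srev]; lia. Qed.

Lemma height0 x q i : height x q i = 0 -> forall p, p < i -> x p < q.
Proof.
elim: i => //= i IH E p; rewrite ltnS leq_eqVlt => /orP[/eqP->|]; first by lia.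
by apply: IH; lia.
Qed.

Lemma height_full x q i : i <= height x q i -> forall p, p < i -> q <= x p.
Proof.
have ub j : height x q j <= j by elim: j => //= j; lia.
elim: i => //= i IH E p; rewrite ltnS leq_eqVlt; have := ub i.
move=> ubi /orP[/eqP->|]; first by lia.
by apply: IH; lia.
Qed.

(** The rows with [q = i] force [x p <= p]; the reflected position gives the opposite inequality. *)
Lemma le_id x : signed x -> bruhat x id -> forall p, p < M -> x p = p.
Proof.
move=> wx /bruhatP H.
have ub p : p < M -> x p <= p.
  move=> pM; have := H p.+1 p.+1; rewrite height_id subnn => /(_ pM pM) E.
  have /height0/(_ p) : height x p.+1 p.+1 = 0 by lia.
  by apply.
move=> p pM; have := ub _ pM; have := ub (M.-1 - p); have := wx.1 _ pM; lia.
Qed.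

Lemma ge_srev x : signed x -> bruhat srev x -> forall p, p < M -> x p = srev p.
Proof.
move=> wx /bruhatP H.
have lb p : p < M -> srev p <= x p.
  move=> pM; have := H (srev p) p.+1; rewrite height_srev // /srev => E.
  have /height_full/(_ p) : p.+1 <= height x (M.-1 - p) p.+1 by lia.
  by apply.
move=> p pM; have := lb _ pM; have := lb (M.-1 - p); have := wx.1 _ pM.
rewrite /srev; lia.
Qed.

Definition inv_at x r := height x (x r).+1 r.
Definition inversions x i := \sum_(r < i) inv_at x r.

(* Twice the Coxeter length. *)
Definition slen x := inversions x M + height x m m.

Lemma slen_ext x y : (forall p, p < M -> x p = y p) -> slen x = slen y.
Proof.
move=> xy; rewrite /slen /inversions; congr (_ + _); last first.
  by apply: height_eq => p pm; apply: xy; lia.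
apply: eq_bigr => r _; rewrite /inv_at xy //.
by apply: height_eq => p pr; apply: xy; apply: ltn_trans pr _.
Qed.

Lemma slen_id : slen id = 0.
Proof.
rewrite /slen height_id subnn addn0 /inversions big1 // => r _.
by rewrite /inv_at height_id; lia.
Qed.

Lemma slen_srev : slen srev = 2 * (m * m).
Proof.
rewrite /slen height_srev; last lia.
have -> : inversions srev M = \sum_(r < M) r.
  apply: eq_bigr => r _; rewrite /inv_at height_srev; last exact: ltnW.
  by have := ltn_ord r; rewrite /srev; lia.
have E i : 2 * (\sum_(r < i) r) = i * i.-1.
  by elim: i => [|i IH]; rewrite ?big_ord0 // big_ord_recr /= mulnDr IH; case: i {IH} => //= i; lia.
have := E M; set s := \sum_(r < M) _; case: (m) s => [|m'] s; lia.
Qed.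

(** Exchanging a descent removes one inversion, and the mirrored exchange, when distinct, another.
    The terms under [moved l i] complete a prefix that ends between two exchanged positions. *)
Lemma inversions_swap l x i : sletter l -> signed x -> x l < x l.-1 -> i <= M ->
  inversions x i + (if moved l i then inv_at x i else 0) =
  inversions (x \o swap l) i + (if moved l i then (inv_at (x \o swap l) i).+1 else 0)
    + (l < i) + ((l != M - l) && (M - l < i)).
Proof.
move=> lM wx xl; elim: i => [|i IH] iM.
  rewrite /inversions !big_ord0 /moved; move: lM; rewrite /sletter; do ?case: ifP; lia.
have {IH} := IH (ltnW iM).
rewrite /inversions !big_ord_recr /= -!/(inversions _ _).
case: (boolP (moved l i.+1)) => mS.
  have [_ _ /= /negbTE mi _] := movedS lM mS; rewrite mi.
  have lt : x i.+1 < x i by have [_ /= ->] := moved_lt lM wx mS.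
  have -> : inv_at (x \o swap l) i = height x (x i.+1).+1 i.
    by rewrite /inv_at height_swap // mi /= /swap mS.
  have -> : inv_at x i.+1 = (height x (x i.+1).+1 i).+1 by rewrite /inv_at /= lt addn1.
  have -> : inv_at (x \o swap l) i.+1 = inv_at x i.
    have [_ _ _ /negbTE mSS] := movedS lM mS.
    rewrite /inv_at height_swap // mS /= /swap mSS mS /=; lia.
  move: mS mi lM; rewrite /moved /sletter; lia.
case: (boolP (moved l i)) => mi; first by move: mS mi lM; rewrite /moved /sletter; lia.
have -> : inv_at (x \o swap l) i = inv_at x i.
  by rewrite /inv_at height_swap // (negbTE mi) /= /swap (negbTE mS) (negbTE mi).
move: mS mi lM; rewrite /moved /sletter; lia.
Qed.

(** For [l] other than [m] two inversions disappear; for [l = m] one does, and the middle row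
    [height x m m] drops by one. *)
Lemma slen_sdn l x : sletter l -> signed x -> ~~ bruhat x (sdn l x) ->
  slen x = (slen (sdn l x)).+2.
Proof.
move=> lM wx; rewrite /sdn; case: ifP => xl; last by rewrite bruhat_refl.
move=> _; have := inversions_swap lM wx xl (leqnn M).
have -> : moved l M = false by move: lM; rewrite /moved /sletter; lia.
rewrite /slen height_swap // /moved !addn0 => ->.
have [E|E] := eqVneq l m; last first.
  by move: lM E; rewrite /sletter; case: ifP; lia.
move: lM xl; rewrite E /sletter ?eqxx /= => lM xl; have := wx.1 m.-1.
have -> : M.-1 - m.-1 = m by lia.
case: (m) lM xl => //= m' lM xl; lia.
Qed.

End SignedPermutations.

(** * Heights and chains in the network *)

Definition lt2 (p r : nat * nat) := (p.1 < r.1) && (p.2 < r.2).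

Lemma gt2_trans : transitive (fun p r => lt2 r p).
Proof. by move=> [a b] [c d] [e f]; rewrite /lt2 /=; lia. Qed.

(** In a strictly decreasing chain, each dropped leading term lowers the bound on both coordinates
    by one. *)
Lemma drop_gt2 (c : seq (nat * nat)) a b d e :
    sorted (fun p r => lt2 r p) c ->
    all (fun p : nat * nat => (p.1 + d <= a) && (p.2 + d <= b)) c ->
  all (fun p : nat * nat => (p.1 + (d + e) <= a) && (p.2 + (d + e) <= b)) (drop e c).
Proof.
elim: c d e => [|p c IH] d [|e] //; first by rewrite drop0 addn0.
rewrite /= (path_sortedE gt2_trans) => /andP[pc sc] /andP[pab cab].
rewrite addnS -addSn; apply: IH => //; apply/allP => r rc.
by have /= := allP pc r rc; rewrite /lt2; lia.
Qed.

Lemma path_lt2_last c p0 : path lt2 p0 c ->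
  all (fun p : nat * nat => (p.1 <= (last p0 c).1) && (p.2 <= (last p0 c).2)) (p0 :: c).
Proof.
elim: c p0 => [|p c IH] p0 /=; first by rewrite !leqnn.
by rewrite /lt2 => /andP[p0p /IH /= /andP[pl ->]]; rewrite pl !andbT; lia.
Qed.

Lemma path_lt2_size c p0 : path lt2 p0 c ->
  p0.1 + size c <= (last p0 c).1 /\ p0.2 + size c <= (last p0 c).2.
Proof.
elim: c p0 => [|p c IH] p0 /=; first by rewrite !addn0.
by rewrite /lt2 => /andP[p0p /IH]; lia.
Qed.

Section Network.
Variables (n k : nat) (S : nat -> nat -> bool).
Local Notation N := (2 * n).
Local Notation M := (2 * (n - k)).
Hypothesis k_gt0 : 0 < k.
Hypothesis k_ltn : k < n.
(** [h q t i] stands for the height of row [i] at time [t]. The parity of [t + i + k] decides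
    whether a row is due for an update, and the segments in [S] are the omitted comparators. *)
Variable h : nat -> nat -> nat -> nat.
Hypothesis h_init : forall q i, i <= M -> h q 0 i = i - q.
Hypothesis h_mono : forall q t i, h q t i <= h q t i.+1.
Hypothesis h_lip : forall q t i, h q t i.+1 <= (h q t i).+1.
Hypothesis h_bot : forall q t, h q t 0 = 0.
Hypothesis h_top : forall q t, t <= N -> h q t M = M - q.
Hypothesis h_idle : forall q t i a, t < N -> i <= M -> 2 * a + i + k + 1 = 2 * N + t ->
  h q t.+1 i = h q t i.
Hypothesis h_step : forall q t i a, t < N -> 0 < i < M -> 2 * a + i + k = 2 * N + t ->
  h q t.+1 i = if S a (a + i + k) then h q t i else minn (h q t i.-1).+1 (h q t i.+1).

(* The row i of the state reached before time t was last updated by the segment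
   [a, b]; times are shifted by 2 N to keep the coordinates nonnegative. *)
Definition node t i a b :=
  b = a + i + k /\ (a + b + 1 = 2 * N + t \/ a + b + 2 = 2 * N + t).

(* Heights count the unit steps of [b] minus the length of a chain of segments of [S]. *)
Lemma trace q t i a b : t <= N -> i <= M -> node t i a b -> h q t i < minn i (M - q) ->
  exists c a0 b0 i0,
    [/\ node 0 i0 a0 b0, [&& i0 <= M, a0 <= a & b0 <= b], h q t i + size c + b0 = (i0 - q) + b,
        sorted (fun p r => lt2 r p) c
      & all (fun p : nat * nat =>
          [&& a0 < p.1, p.1 <= a, b0 < p.2, p.2 <= b & S p.1 p.2]) c].
Proof.
elim: t i a b => [|t IH] i a b tN iM nd hlt.
  exists [::], a, b, i; split=> //=; first by rewrite iM !leqnn.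
  by rewrite h_init // addn0.
case: (nd) => Eb [E|E]; last first.
  move: hlt; rewrite (@h_idle _ _ _ a) => //; last lia.
  by move=> hlt; apply: (IH i a b) => //; [lia | split=> //; lia].
(* The strict bound on the height keeps the traced path off the rows 0 and [M]. *)
have i0 : 0 < i by move: hlt; lia.
have iM' : i < M.
  case: (ltngtP i M) iM => // Ei _; move: hlt; rewrite Ei h_top //; lia.
have a0 : 0 < a by lia.
have Eh := @h_step q t i a tN; rewrite -Eb in Eh; move: hlt; rewrite Eh; try lia.
(* At a segment of [S] the path goes straight back in its row and the segment joins the chain.
   Otherwise it follows the term attaining the minimum, lowering [b] or [a] by one. *)
rewrite {Eh}; case: (boolP (S a b)) => Sab hlt.
  have [||||c [a1 [b1 [i1 [n1 i1M sz so al]]]]] := IH i a.-1 b.-1; try lia.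
    by split; lia.
  exists ((a, b) :: c), a1, b1, i1; split=> //=; [lia | lia | |].
    rewrite (path_sortedE gt2_trans) so andbT; apply/allP => p pc.
    by have := allP al _ pc; rewrite /lt2 /=; lia.
  rewrite Sab !leqnn andbT; apply/andP; split; first by lia.
  by apply/allP => p pc; have := allP al _ pc; lia.
case: (leqP (h q t i.-1).+1 (h q t i.+1)) => cmp.
  have {}hlt : (h q t i.-1).+1 < minn i (M - q) by lia.
  have [||||c [a1 [b1 [i1 [n1 i1M sz so al]]]]] := IH i.-1 a b.-1; try lia.
    by split; lia.
  exists c, a1, b1, i1; split=> //; [lia | lia |].
  by apply/allP => p pc; have := allP al _ pc; lia.
have [||||c [a1 [b1 [i1 [n1 i1M sz so al]]]]] := IH i.+1 a.-1 b; try lia.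
  by split; lia.
exists c, a1, b1, i1; split=> //; first by lia.
by apply/allP => p pc; have := allP al _ pc; lia.
Qed.

(** Each segment has one end in (a0, b0] and the other in (b0, a0 + N]; inside this window a strict
    chain consists of pairwise crossing segments. *)
Definition crossing_seq (c : seq (nat * nat)) a0 b0 :=
  [/\ size c = k.+1, sorted (fun p r => lt2 r p) c
    & all (fun p : nat * nat =>
        [&& a0 < p.1, p.1 <= b0, b0 < p.2, p.2 <= a0 + N & S p.1 p.2]) c].

Lemma low_height_crossing q : q <= M -> h q N (M - q) < M - q ->
  exists c a0 b0, crossing_seq c a0 b0.
Proof.
(* The node of row [M - q] at time [N]; the rounding settles the parity. *)
move=> qM hlt; pose a := (3 * N - (M - q) - k - 1) %/ 2; pose b := a + (M - q) + k.
have nd : node N (M - q) a b by rewrite /node /b /a; split=> //; lia.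
have iM : M - q <= M by lia.
have hl : h q N (M - q) < minn (M - q) (M - q) by rewrite minnn.
have [c [a0 [b0 [i0 [n0 i0M sz so al]]]]] := trace (leqnn N) iM nd hl.
(* The excess of the final node over the window: dropping [e] terms brings the chain inside, and the
   low height leaves at least k + 1 of them. *)
pose e := maxn (a - b0) (b - (a0 + N)).
have szc : k.+1 + e <= size c.
  case: nd => Eb Et; case: n0 => Eb0 Et0; rewrite /e; lia.
have al' := @drop_gt2 c a b 0 e so.
have {}al' : all (fun p : nat * nat => (p.1 + e <= a) && (p.2 + e <= b)) (drop e c).
  by apply: al'; apply/allP => p pc; have := allP al _ pc; lia.
exists (take k.+1 (drop e c)), a0, b0; split.
- by rewrite size_takel // size_drop; lia.
- exact/take_sorted/drop_sorted.
apply/allP => p /mem_take pc; have := allP al' _ pc; have := allP al _ (mem_drop pc).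
by rewrite /e; lia.
Qed.

Lemma h_monoD q t i d : h q t i <= h q t (i + d).
Proof. by elim: d => [|d IH]; rewrite ?addn0 // addnS (leq_trans IH). Qed.

Lemma h_lipD q t i d : h q t (i + d) <= h q t i + d.
Proof.
by elim: d => [|d IH]; rewrite ?addn0 // addnS; have := h_lip q t (i + d); lia.
Qed.

(** Whatever [S] is, a step in [a] does not raise the height and a step in [b] raises it by at most
    one. *)
Lemma node_height_le q t i a b t' i' a' b' :
    node t i a b -> node t' i' a' b' -> i <= M -> i' <= M -> t <= t' -> t' <= N ->
    a <= a' -> b <= b' ->
  h q t' i' + b <= h q t i + b'.
Proof.
move=> nd nd' iM; elim: t' i' a' b' nd' => [|t' IH] i' a' b' nd' i'M tt' t'N aa' bb'.
  have t0 : t = 0 by lia.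
  subst t; case: nd nd' => Eb Et [Eb' Et'].
  by rewrite !h_init //; lia.
case: (ltngtP t t'.+1) tt' => // [tt'|tt'] _; last first.
  subst t; case: nd nd' => Eb Et [Eb' Et'].
  case: (leqP i i') => ii.
    by have := h_lipD q t'.+1 i (i' - i); rewrite subnKC //; lia.
  by have := h_monoD q t'.+1 i' (i - i'); rewrite subnKC; lia.
case: (nd) => Eb Et; case: (nd') => Eb' [Et'|Et']; last first.
  rewrite (@h_idle _ _ _ a') //; try lia.
  by apply: (IH i' a' b') => //; [split=> // | ]; lia.
have [i0|i0] := posnP i'.
  by rewrite i0 h_bot; lia.
case: (ltngtP i' M) i'M => // [iM'|iM'] _; last first.
  rewrite iM' h_top // -(@h_top q t); last lia.
  by have := h_lipD q t i (M - i); rewrite subnKC //; lia.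
have le_r : h q t'.+1 i' <= h q t' i'.+1.
  by rewrite (@h_step _ _ _ a') ?i0 //; try lia; case: ifP => _; rewrite ?h_mono ?geq_minr.
have le_l : h q t'.+1 i' <= (h q t' i'.-1).+1.
  rewrite (@h_step _ _ _ a') ?i0 //; try lia; case: ifP => _; rewrite ?geq_minl //.
  by have := h_lip q t' i'.-1; rewrite prednK.
case: (ltngtP a a') aa' => // [aa'|aa'] _.
  apply: leq_trans (_ : h q t' i'.+1 + b <= _); first by rewrite leq_add2r.
  by apply: (IH i'.+1 a'.-1 b') => //; first split; lia.
have nd2 : node t' i'.-1 a' b'.-1 by split; lia.
have := IH _ _ _ nd2; lia.
Qed.

(** At each segment of the chain the comparator is missing: [b] advances by one while the height
    stays, a gain of one over [node_height_le]. *)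
Lemma chain_height_le q c t i a b i' a' b' :
    node t i a b -> node N i' a' b' -> i <= M -> i' <= M -> t <= N ->
    a <= a' -> b <= b' -> path lt2 (a, b) c ->
    all (fun p : nat * nat => [&& p.1 <= a', p.2 <= b', p.1 + k < p.2, p.2 < p.1 + (M + k),
      2 * N <= p.1 + p.2, p.1 + p.2 < 3 * N & S p.1 p.2]) c ->
  h q N i' + size c + b <= h q t i + b'.
Proof.
move=> nd nd' iM i'M; elim: c t i a b nd iM => [|[a1 b1] c IH] t i a b nd iM tN aa' bb' /=.
  by move=> _ _; rewrite addn0; exact: (node_height_le q nd nd').
rewrite /lt2 /= => /andP[/andP[aa1 bb1] pc] /andP[/and5P[a1a' b1b' lo hi /and3P[t0 t1 Sab]] al].
pose t2 := a1 + b1 - 2 * N; pose i1 := b1 - a1 - k.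
have Eb : b1 = a1 + i1 + k by rewrite /i1; lia.
have t2N : t2 < N by rewrite /t2; lia.
have n1 : node t2.+1 i1 a1 b1 by split=> //; left; rewrite /t2; lia.
have n2 : node t2 i1 a1.-1 b1.-1 by split; [lia | right; rewrite /t2; lia].
have i1M : i1 <= M by rewrite /i1; lia.
have := IH _ _ _ _ n1 i1M t2N a1a' b1b' pc al.
have := @node_height_le q _ _ _ _ _ _ _ _ nd n2 iM i1M.
rewrite (@h_step _ _ _ a1) //; [|rewrite /i1; lia | rewrite /i1 /t2; lia].
rewrite -Eb Sab; case: nd => _ Et; rewrite /t2; lia.
Qed.

Lemma crossing_low_height c : size c = k.+1 -> sorted lt2 c ->
    all (fun p : nat * nat => [&& p.1 + k < p.2, p.2 < p.1 + (M + k),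
      2 * N <= p.1 + p.2, p.1 + p.2 < 3 * N & S p.1 p.2]) c ->
    (forall p r : nat * nat, p \in c -> r \in c -> (r.1 < p.2) && (r.2 < p.1 + N)) ->
  exists2 q, q <= M & h q N (M - q) < M - q.
Proof.
case: c => // -[a1 b1] c sz so al cr.
pose p2 := last (a1, b1) c; pose a2 := p2.1; pose b2 := p2.2.
have p2c : p2 \in (a1, b1) :: c by exact: mem_last.
have ub : all (fun p : nat * nat => (p.1 <= a2) && (p.2 <= b2)) ((a1, b1) :: c)
  by exact: path_lt2_last.
have /= /and5P[lo1 hi1 t01 t11 _] := allP al _ (mem_head _ _).
have /and5P[lo2 hi2 t02 t12 _] := allP al _ p2c.
have /= := cr _ _ (mem_head _ _) p2c; rewrite -/a2 -/b2 => /andP[a2b1 b2a1].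
have kgap : b1 + k <= b2 /\ a1 + k <= a2.
  by case: sz => <-; have [] := path_lt2_size so.
(* A starting node strictly below the whole chain, such that the final node [(b0, a0 + N)] dominates
   it. [T] is its coordinate sum, which must be smaller by one more if the first segment has time
   0. *)
pose T := if a1 + b1 == 2 * N then 2 * N - 2 else 2 * N - 1.
pose a0 := maxn (b2 - N) (T - b1.-1); pose b0 := T - a0.
have [Ta [Tb [a0a1 [b0b1 [a2b0 [b2a0 le0]]]]]] : (a0 + b0 = T) /\ (T = 2 * N - 2 \/ T = 2 * N - 1)
    /\ a0 < a1 /\ b0 < b1 /\ a2 <= b0 /\ b2 <= a0 + N /\ True.
  move: lo2 hi2 t02 t12; rewrite -/a2 -/b2 /b0 /a0 /T; case: eqP; lia.
(* With [q = i0] the starting node has height 0, so the bound of [chain_height_le] falls below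
   [M - q]. *)
pose i0 := b0 - a0 - k; exists i0; first by rewrite /i0; lia.
have i0M : i0 <= M by rewrite /i0; lia.
have n0 : node 0 i0 a0 b0 by split; rewrite /i0; lia.
have n1 : node N (M - i0) b0 (a0 + N) by split; rewrite /i0; lia.
have pa : path lt2 (a0, b0) ((a1, b1) :: c) by rewrite /= /lt2 a0a1 b0b1.
have := @chain_height_le i0 _ _ _ _ _ _ _ _ n0 n1 i0M _ _ _ _ pa.
rewrite h_init // subnn sz.
suff al' : all (fun p : nat * nat => [&& p.1 <= b0, p.2 <= a0 + N, p.1 + k < p.2,
    p.2 < p.1 + (M + k), 2 * N <= p.1 + p.2, p.1 + p.2 < 3 * N & S p.1 p.2]) ((a1, b1) :: c).
  by move=> /(_ _ _ _ _ al'); rewrite /i0; lia.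
apply/allP => p pc; have := allP al _ pc; have := allP ub _ pc; lia.
Qed.

End Network.

(** * Segments of the polygon *)

Lemma eq_modn_cases N a c : a = c %[mod N] -> a < 3 * N -> c < 3 * N ->
  a = c \/ a = c + N \/ c = a + N \/ a = c + 2 * N \/ c = a + 2 * N.
Proof.
move=> E aN cN; have N0 : 0 < N by lia.
have := divn_eq a N; have := divn_eq c N; rewrite E.
have : a %/ N < 3 by rewrite ltn_divLR.
have : c %/ N < 3 by rewrite ltn_divLR.
move: (c %% N) => r.
by case: (a %/ N) => [|[|[|]]] //; case: (c %/ N) => [|[|[|]]] //; lia.
Qed.

Section Polygon.
Variable n : nat.
Local Notation N := (2 * n).
Hypothesis N_gt0 : 0 < N.

(** Endpoints are natural numbers read modulo [N], so segments of the strip can be used directly. *)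
Definition vtx (a : nat) : vertex n := Ordinal (ltn_pmod a N_gt0).
Definition chord (a b : nat) : segment n := [set vtx a; vtx b].

Lemma vtx_ord (v : vertex n) : vtx v = v.
Proof. by apply: val_inj; rewrite /= modn_small. Qed.

Lemma vtx_mod a c : a = c %[mod N] -> vtx a = vtx c.
Proof. by move=> E; apply: val_inj. Qed.

Lemma chordC a b : chord a b = chord b a.
Proof. exact: setUC. Qed.

Lemma chord_mod a b c d : a = c %[mod N] -> b = d %[mod N] -> chord a b = chord c d.
Proof. by move=> /vtx_mod E /vtx_mod E'; rewrite /chord E E'. Qed.

Lemma chordDl a b : chord (a + N) b = chord a b.
Proof. by apply: chord_mod => //; rewrite modnDr. Qed.

Lemma chordDr a b : chord a (b + N) = chord a b.
Proof. by apply: chord_mod => //; rewrite modnDr. Qed.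

Lemma chord_inj a b c d : chord a b = chord c d ->
  (a = c %[mod N] /\ b = d %[mod N]) \/ (a = d %[mod N] /\ b = c %[mod N]).
Proof.
move=> /setP E.
have := E (vtx a); have := E (vtx b); have := E (vtx c); have := E (vtx d).
rewrite !inE !eqxx ?orbT /= -!val_eqE /=.
by move: (a %% N) (b %% N) (c %% N) (d %% N) => *; lia.
Qed.

Lemma rotate_vertexK : involutive (@rotate_vertex n).
Proof.
by move=> v; apply: val_inj; rewrite /= modnDml -addnA addnn -mul2n modnDr modn_small.
Qed.

Lemma rotateK : involutive (@rotate n).
Proof.
move=> s; rewrite /rotate -imset_comp -[RHS]imset_id; apply: eq_imset => v /=.
exact: rotate_vertexK.
Qed.

Lemma rotate_chord a b : rotate (chord a b) = chord (a + n) (b + n).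
Proof.
have E c : rotate_vertex (vtx c) = vtx (c + n) by apply: val_inj; rewrite /= modnDml.
by rewrite /rotate /chord imsetU1 imset_set1 !E.
Qed.

Lemma rotation_orbit_rotate (s : segment n) : rotation_orbit (rotate s) = rotation_orbit s.
Proof. by rewrite /rotation_orbit rotateK setUC. Qed.

Lemma crossing_chord4 a b c d : a < b -> b < c -> c < d -> d < N ->
  crossing (chord a c) (chord b d) /\ crossing (chord b d) (chord a c).
Proof.
move=> ab bc cd dN.
by split; apply/existsP; exists (vtx a); apply/existsP; exists (vtx b);
  apply/existsP; exists (vtx c); apply/existsP; exists (vtx d);
  rewrite /= !modn_small ?eqxx ?orbT ?andbT; lia.
Qed.

Lemma crossingE (s t : segment n) : crossing s t -> exists a b c d,
  [/\ a < b, b < c, c < d, d < N &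
    (s = chord a c /\ t = chord b d) \/ (s = chord b d /\ t = chord a c)].
Proof.
case/existsP=> a /existsP[b /existsP[c /existsP[d /and4P[ab bc cd st]]]].
exists a, b, c, d; split=> //; rewrite /chord !vtx_ord.
by case/orP: st => /andP[/eqP-> /eqP->]; [left | right].
Qed.

Lemma crossing_irr (s : segment n) : ~~ crossing s s.
Proof.
apply/negP => /crossingE[a [b [c [d [ab bc cd dN]]]]].
case=> -[-> /chord_inj]; rewrite !modn_small; lia.
Qed.

Lemma crossing_chord a b c d : a < c -> c < b -> b < d -> d < a + N ->
  crossing (chord a b) (chord c d) /\ crossing (chord c d) (chord a b).
Proof.
wlog aN : a b c d / a < N => [W ac cb bd da|].
  pose r := a %% N; have rN : r < N by rewrite ltn_mod.
  have E x : a <= x -> r + (x - a) = x %[mod N].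
    by move=> ax; rewrite modnDml subnKC.
  have <- : chord (r + (a - a)) (r + (b - a)) = chord a b by apply: chord_mod; apply: E; lia.
  have <- : chord (r + (c - a)) (r + (d - a)) = chord c d by apply: chord_mod; apply: E; lia.
  by apply: W; lia.
(* With [a < N], the cases are which of [d], [b], [c] have passed [N]; those return to the front of
   the cyclic order. *)
move=> ac cb bd da; case: (ltnP d N) => dN; first exact: crossing_chord4.
rewrite -(subnK dN) chordDr; case: (ltnP b N) => bN.
  by rewrite [chord c _]chordC; have [] := @crossing_chord4 (d - N) a c b; lia.
rewrite -(subnK bN) chordDr [chord a _]chordC; case: (ltnP c N) => cN.
  by rewrite [chord c _]chordC; have [] := @crossing_chord4 (b - N) (d - N) a c; lia.
by rewrite -(subnK cN) chordDl; have [] := @crossing_chord4 (c - N) (b - N) (d - N) a; lia.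
Qed.

Section Omega.
Variable k : nat.

Lemma chord_Omega a b : a + k < b -> b + k < a + N -> chord a b \in Omega n k.
Proof.
have base c d : c + k < d -> d + k < c + N -> d < N -> chord c d \in Omega n k.
  move=> cd dc dN; rewrite inE; apply/existsP; exists (vtx c); apply/existsP; exists (vtx d).
  by rewrite eqxx /= -val_eqE /= /cyclic_length /= !modn_small; lia.
move=> ab ba; pose r := a %% N; have rN : r < N by rewrite ltn_mod.
have -> : chord a b = chord r (r + (b - a)).
  by apply: chord_mod; rewrite ?modn_mod // modnDml subnKC //; lia.
case: (ltnP (r + (b - a)) N) => dN; first by apply: base; lia.
by rewrite -(subnK dN) chordDr chordC; apply: base; lia.
Qed.

Lemma OmegaE s : s \in Omega n k -> exists a b,
  [/\ s = chord a b, a + k < b, b + k < a + N & b < N].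
Proof.
rewrite inE => /existsP[a /existsP[b /and3P[/eqP-> ab len]]].
have aN := ltn_ord a; have bN := ltn_ord b.
case: (ltngtP a b) => [lt|lt|/val_inj E]; last by rewrite E eqxx in ab.
  exists a, b; rewrite /chord !vtx_ord; split=> //; move: len; rewrite /cyclic_length; lia.
exists b, a; rewrite /chord !vtx_ord setUC; split=> //; move: len; rewrite /cyclic_length; lia.
Qed.

End Omega.

End Polygon.

Arguments height : simpl never.

(** * The word of rotation orbits *)

Section Word.
Variables n k : nat.
Hypothesis k_gt0 : 0 < k.
Hypothesis k_ltn : k < n.
Local Notation N := (2 * n).
Local Notation m := (n - k).
Local Notation M := (2 * (n - k)).

Lemma polygon_gt0 : 0 < N.
Proof. lia. Qed.
Local Notation seg := (chord polygon_gt0).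

(* The segment [a, b] with b - a = i + k and a + b = 2 N + t; junk unless t + i + k is even. *)
Definition wseg t i : segment n :=
  let a := (2 * N + t - i - k) %/ 2 in seg a (a + i + k).

Definition worb t i : {set segment n} := rotation_orbit (wseg t i).

(** The half-turn exchanges rows [i] and [M - i], so rows up to [m] represent all orbits. Letters of
    one time have rows of equal parity and commute. *)
Definition levels t := [seq i <- iota 1 m | ~~ odd (t + i + k)].

(* Later letters come first, as [demazure] lets the head act last. *)
Fixpoint word t : seq ({set segment n} * nat) :=
  if t is t'.+1 then [seq (worb t' i, i) | i <- levels t'] ++ word t' else [::].

Lemma levelsP t i : reflect (0 < i <= m /\ exists a, 2 * a + i + k = 2 * N + t) (i \in levels t).
Proof.
rewrite mem_filter mem_iota.
apply: (iffP andP) => [[ev im]|[im [a Ea]]]; last by split; lia.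
split; first by lia.
by exists ((2 * N + t - i - k) %/ 2); lia.
Qed.

Lemma wsegE t i a : 2 * a + i + k = 2 * N + t -> wseg t i = seg a (a + i + k).
Proof. by move=> E; rewrite /wseg (_ : _ %/ 2 = a) //; lia. Qed.

Lemma word_letters t : all (fun p => sletter m p.2) (word t).
Proof.
elim: t => //= t IH; rewrite all_cat IH andbT; apply/allP => _ /mapP[i /levelsP[im _] ->] /=.
by rewrite /sletter; lia.
Qed.

Lemma mem_word v t : reflect (exists t' i, [/\ t' < t, i \in levels t' & v = worb t' i])
  (v \in unzip1 (word t)).
Proof.
elim: t => [|t IH] /=; first by constructor=> -[? [? []]].
rewrite /unzip1 map_cat mem_cat -map_comp; apply: (iffP orP).
  case=> [/mapP[i il ->]|/IH[t' [i [lt il ->]]]]; first by exists t, i.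
  by exists t', i; split=> //; exact: ltnW.
move=> [t' [i [lt il vE]]]; move: lt; rewrite ltnS leq_eqVlt => /predU1P[E|lt].
  by left; rewrite vE; apply/mapP; exists i; rewrite // -E.
by right; apply/IH; exists t', i.
Qed.

Lemma worb_inj t i t' i' : t < N -> t' < N -> i \in levels t -> i' \in levels t' ->
  worb t i = worb t' i' -> t = t' /\ i = i'.
Proof.
move=> tN t'N /levelsP[im [a Ea]] /levelsP[im' [a' Ea']] E.
have : wseg t i \in worb t' i' by rewrite -E !inE eqxx.
rewrite !inE (wsegE Ea) (wsegE Ea') rotate_chord.
by case/orP=> /eqP /chord_inj[] [/eq_modn_cases e1 /eq_modn_cases e2]; lia.
Qed.

Lemma word_uniq : uniq (unzip1 (word N)).
Proof.
suff : forall t, t <= N -> uniq (unzip1 (word t)) by apply.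
elim=> //= t IH tN; rewrite /unzip1 map_cat cat_uniq -/(unzip1 _) IH ?(ltnW tN) // andbT.
apply/andP; split.
  rewrite /unzip1 -map_comp map_inj_in_uniq; first exact/filter_uniq/iota_uniq.
  by move=> i j il jl /worb_inj[].
apply/hasPn => v /mem_word[t' [i [lt il ->]]]; apply/negP; rewrite /= /unzip1 -map_comp.
by case/mapP => j jl /worb_inj[]; lia || exact: ltn_trans lt tN.
Qed.

Lemma word_orbits : [set:: unzip1 (word N)] = orbits n k.
Proof.
apply/setP => v; rewrite inE; apply/mem_word/imsetP.
  move=> [t [i [tN /levelsP[im [a Ea]] ->]]]; exists (wseg t i) => //.
  by rewrite (wsegE Ea); apply: chord_Omega; lia.
move=> [s /(OmegaE polygon_gt0)[a [b [-> ab ba bN]]] ->].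
have in_word t i c : t < N -> 0 < i <= m -> 2 * c + i + k = 2 * N + t ->
    rotation_orbit (seg c (c + i + k)) = rotation_orbit (seg a b) ->
    exists t' i', [/\ t' < N, i' \in levels t' & rotation_orbit (seg a b) = worb t' i'].
  move=> tN im Ec <-; exists t, i; split=> //; last by rewrite /worb (wsegE Ec).
  by apply/levelsP; split=> //; exists c.
(* The side of the segment of length at most [n] is used, and a shift by [N] or a half-turn brings
   its time into the window. *)
case: (leqP (b - a) n) => d; case: (ltnP (a + b) N) => ts.
- apply: (in_word (a + b) (b - a - k) (a + N)); try lia; congr rotation_orbit.
  by rewrite chordDl (_ : _ + k = b + N) ?chordDr //; lia.
- apply: (in_word (a + b - N) (b - a - k) (a + n)); try lia.
  by rewrite (_ : _ + k = b + n) -?rotate_chord ?rotation_orbit_rotate //; lia.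
- apply: (in_word (a + b) (N - (b - a) - k) (b + n)); try lia.
  rewrite (_ : _ + k = a + N + n) -?rotate_chord ?rotation_orbit_rotate ?chordDr; last lia.
  by rewrite chordC.
- apply: (in_word (a + b - N) (N - (b - a) - k) b); try lia.
  rewrite (_ : _ + k = a + N) ?chordDr; last lia.
  by rewrite chordC.
Qed.

(** Two consecutive times together use each row from 1 to [m] once. *)
Lemma size_word : size (word N) = n * m.
Proof.
suff : forall j, size (word (2 * j)) = j * m by apply.
elim=> [|j IH]; first by rewrite muln0.
rewrite mulnS /= !size_cat !size_map IH mulSn addnA; congr (_ + _).
rewrite !size_filter -[RHS](size_iota 1 m) -(count_predC (fun i => ~~ odd ((2 * j).+1 + i + k))).
congr (_ + _); apply: eq_count => i /=; lia.
Qed.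

Lemma cover_orbits (sigma : {set {set segment n}}) (s : segment n) :
  sigma \subset orbits n k -> (s \in cover sigma) = (rotation_orbit s \in sigma).
Proof.
move=> /subsetP so; apply/bigcupP/idP => [[o os]|sS]; last first.
  by exists (rotation_orbit s); rewrite // !inE eqxx.
have /imsetP[s0 _ oE] := so _ os; move: os; rewrite oE => os.
by rewrite !inE => /orP[] /eqP->; rewrite ?rotation_orbit_rotate.
Qed.

(** * The network of the letters outside a set of orbits *)

Section State.
Variable sigma : {set {set segment n}}.
Hypothesis sigma_sub : sigma \subset orbits n k.

Definition state t := demazure (sup m) id (word t) sigma.

Definition updated t l j := has (fun i => moved m i j && (worb t i \notin sigma)) l.

Lemma signed_state t : signed m (state t).
Proof.
exact: (wf_demazure (signed_sup (m := m)) (signed_id m) sigma (word_letters t)).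
Qed.

(** All letters of one time move rows of one parity and read rows of the other, so they act as if
    simultaneously. *)
Lemma height_state t q j : height (state t.+1) q j =
  if updated t (levels t) j
  then minn (height (state t) q j.-1).+1 (height (state t) q j.+1)
  else height (state t) q j.
Proof.
pose slice l := foldr (fun p y => if p.1 \in sigma then y else sup m p.2 y) (state t)
  [seq (worb t i, i) | i <- l].
have -> : state t.+1 = slice (levels t) by rewrite /state /= /demazure foldr_cat.
have : all (fun i => (0 < i <= m) && ~~ odd (t + i + k)) (levels t).
  by apply/allP => i /levelsP[im [a Ea]]; rewrite im /=; lia.
elim: (levels t) j => //= i l IH j /andP[/andP[im ie] ev].
have sl : signed m (slice l).
  elim: l {IH} ev => [|i' l IH] /=; first by move=> _; exact: signed_state.
  move=> /andP[/andP[im' _] /IH IHl]; rewrite /slice /= -/(slice l); case: ifP => // _.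
  by apply: signed_sup => //; rewrite /sletter; lia.
have {}IH j' := IH j' ev.
rewrite /slice /= -/(slice l); case: (boolP (worb t i \in sigma)) => io /=; first by rewrite andbF IH.
have li : sletter m i by rewrite /sletter; lia.
rewrite height_sup // andbT; case: (boolP (moved m i j)) => mj /=; last exact: IH.
have no j' : odd (j + j') -> updated t l j' = false.
  move=> oj; apply/negbTE/hasPn => i' i'l; apply/nandP; left.
  have /andP[im' ie'] := allP ev _ i'l.
  by move: mj; rewrite /moved; lia.
have [j0 _ _ _] := movedS li mj.
by rewrite !IH !no //; lia.
Qed.

Lemma odd_updated t j : ~~ ((0 < j < M) && ~~ odd (t + j + k)) -> updated t (levels t) j = false.
Proof.
move=> nj; apply/negbTE/hasPn => i /levelsP[im [a Ea]]; apply/nandP; left.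
by move: nj; rewrite /moved; lia.
Qed.

(** Row [j] is moved by the letter [minn j (M - j)]; in the upper half its segment is the half-turn
    image of the one naming the letter. *)
Lemma updatedE t j a : 0 < j < M -> 2 * a + j + k = 2 * N + t ->
  updated t (levels t) j = (seg a (a + j + k) \notin cover sigma).
Proof.
move=> jM Ea; rewrite cover_orbits //.
pose i := minn j (M - j).
have oE : worb t i = rotation_orbit (seg a (a + j + k)).
  rewrite /worb /i; case: (leqP j (M - j)) => ji; first by rewrite (wsegE Ea).
  have E : 2 * (a + j + k - n) + (M - j) + k = 2 * N + t by lia.
  rewrite (wsegE E) -rotation_orbit_rotate rotate_chord chordC; congr rotation_orbit.
  rewrite (_ : _ + k + n = a + N); last by lia.
  by rewrite chordDl (_ : _ - n + n = a + j + k) //; lia.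
rewrite -oE; apply/hasP/idP => [[i' /levelsP[im' _] /andP[mi]]|no].
  by have -> : i' = i by move: mi; rewrite /moved /i; lia.
exists i; last by rewrite no andbT /moved /i; lia.
by apply/levelsP; rewrite /i; split; [lia | exists ((2 * N + t - minn j (M - j) - k) %/ 2); lia].
Qed.

Let h q t i := height (state t) q i.

Lemma state_init q i : i <= M -> h q 0 i = i - q.
Proof. by move=> _; rewrite /h /state /= height_id. Qed.

Lemma state_idle q t i a : t < N -> i <= M -> 2 * a + i + k + 1 = 2 * N + t ->
  h q t.+1 i = h q t i.
Proof. by move=> _ _ Ea; rewrite /h height_state odd_updated //; lia. Qed.

Lemma state_step q t i a : t < N -> 0 < i < M -> 2 * a + i + k = 2 * N + t ->
  h q t.+1 i = if seg a (a + i + k) \in cover sigma then h q t i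
    else minn (h q t i.-1).+1 (h q t i.+1).
Proof. by move=> _ iM Ea; rewrite /h height_state (updatedE iM Ea) if_neg. Qed.

Lemma state_top q t : t <= N -> h q t M = M - q.
Proof.
move=> _; elim: t => [|t IH]; first exact: state_init.
by rewrite /h height_state odd_updated //; lia.
Qed.

(** Heights grow by 0 or 1 per row, and those of [srev] are [minn i (M - q)]; comparison at the bend
    [i = M - q] implies the rest. *)
Lemma srev_stateP : reflect (forall q, q <= M -> M - q <= h q N (M - q))
  (bruhat m (srev m) (state N)).
Proof.
apply: (iffP (bruhatP _ _ _)) => [H q qM|H q i qM iM].
  by have := H q (M - q) qM; rewrite height_srev /h; lia.
have := H q qM; rewrite /h height_srev //.
have [iq|iq] := leqP i (M - q).
  by have := height_lipD (state N) q i (M - q - i); rewrite subnKC //; lia.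
by have := height_monoD (state N) q (M - q) (i - (M - q)); rewrite subnKC; lia.
Qed.

(** * Crossings and low heights *)

Lemma has_crossing_chain c a0 b0 :
  crossing_seq n k (fun a b => seg a b \in cover sigma) c a0 b0 ->
  has_crossing k.+1 (cover sigma).
Proof.
move=> [sz so al].
have cr (p r : nat * nat) : p \in c -> r \in c -> p != r ->
    crossing (seg p.1 p.2) (seg r.1 r.2).
  wlog pr : p r / lt2 p r => [W pc rc npr|pc rc _].
    have : lt2 p r || lt2 r p.
      elim: c so pc rc {sz al W} => //= p' c IH; rewrite (path_sortedE gt2_trans).
      move=> /andP[/allP al so]; rewrite !inE => /predU1P[pE|pc] /predU1P[rE|rc].
      - by rewrite pE rE eqxx in npr.
      - by rewrite pE al ?orbT.
      - by rewrite rE al.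
      - exact: IH.
    case/orP=> pr; first exact: W.
    move: pr; rewrite /lt2 => /andP[pr1 pr2].
    have /and5P[p1 p2 p3 p4 _] := allP al _ pc; have /and5P[r1 r2 r3 r4 _] := allP al _ rc.
    have [||||_ //] := @crossing_chord _ polygon_gt0 r.1 r.2 p.1 p.2 => //.
      exact: leq_ltn_trans p2 r3.
    by apply: leq_ltn_trans p4 _; rewrite ltn_add2r.
  move: pr; rewrite /lt2 => /andP[pr1 pr2].
  have /and5P[p1 p2 p3 p4 _] := allP al _ pc; have /and5P[r1 r2 r3 r4 _] := allP al _ rc.
  have [||||//] := @crossing_chord _ polygon_gt0 p.1 p.2 r.1 r.2 => //.
    exact: leq_ltn_trans r2 p3.
  by apply: leq_ltn_trans r4 _; rewrite ltn_add2r.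
pose L := [seq seg p.1 p.2 | p <- c].
(* Different terms of the chain give different segments, since they cross and no segment crosses
   itself. *)
have uL : uniq L.
  rewrite map_inj_in_uniq; last first.
    move=> p r pc rc E; apply/eqP/negPn/negP => npr; have := cr _ _ pc rc npr.
    by rewrite E (negbTE (crossing_irr polygon_gt0 _)).
  apply: (@sorted_uniq _ (fun p r => lt2 r p)) so; first exact: gt2_trans.
  by move=> p; rewrite /lt2; lia.
apply/existsP; exists [set:: L]; apply/and3P; split.
- apply/subsetP => s; rewrite inE => /mapP[p pc ->].
  by have /and5P[] := allP al _ pc.
- by rewrite cardsE (card_uniqP uL) size_map sz.
apply/forall_inP => s; rewrite inE => /mapP[p pc ->]; apply/forall_inP => s'.
rewrite inE => /mapP[r rc ->]; apply/implyP => npr; apply: cr => //.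
by apply: contraNneq npr => ->.
Qed.

(* The lift of a segment whose time lies in the window [2 N, 3 N). *)
Definition lift2 a b : nat * nat := if a + b < N then (a + N, b + N) else (b, a + N).

(** The default [(0, 0)] never occurs for segments of [Omega n k], which have two endpoints. *)
Definition lift_seg (s : segment n) : nat * nat :=
  if [pick p : vertex n * vertex n | (s == [set p.1; p.2]) && (p.1 < p.2)] is Some p
  then lift2 p.1 p.2 else (0, 0).

Lemma seg_lift2 a b : seg (lift2 a b).1 (lift2 a b).2 = seg a b.
Proof.
by rewrite /lift2; case: ifP => _ /=; rewrite ?chordDl chordDr // chordC.
Qed.

Lemma lift_segP s : s \in Omega n k -> exists a b,
  [/\ s = seg a b, a + k < b, b + k < a + N, b < N & lift_seg s = lift2 a b].
Proof.
move=> /(OmegaE polygon_gt0)[a [b [sE ab ba bN]]]; exists a, b; split=> //.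
rewrite /lift_seg; case: pickP => [[u v] /andP[/eqP E uv]|none] /=.
  have uvs : s = seg u v by rewrite /chord !vtx_ord.
  have := ltn_ord u; have := ltn_ord v => vN uN.
  move: uv; rewrite /= => uv.
  have [] : u = a :> nat /\ v = b :> nat; last by move=> -> ->.
  by move: uvs; rewrite sE => /chord_inj; rewrite !modn_small; lia.
by have := none (vtx polygon_gt0 a, vtx polygon_gt0 b); rewrite /= sE eqxx /= !modn_small; lia.
Qed.

(** Turns crossing into comparability in both coordinates, so that sorted lifts form a chain for
    [crossing_low_height]. *)
Lemma crossing_lift2 a b c d : a < b -> b < N -> c < d -> d < N ->
    crossing (seg a b) (seg c d) ->
  let p := lift2 a b in let r := lift2 c d in
  [&& lt2 p r, r.1 < p.2 & r.2 < p.1 + N] || [&& lt2 r p, p.1 < r.2 & p.2 < r.1 + N].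
Proof.
move=> ab bN cd dN /(crossingE polygon_gt0)[u [v [w [z [uv vw wz zN]]]]].
case=> -[/chord_inj e1 /chord_inj e2].
  have {e1 e2} [-> [-> [-> ->]]] : a = u /\ b = w /\ c = v /\ d = z.
    by move: e1 e2; rewrite !modn_small; lia.
  rewrite /lift2 /lt2; case: (ltnP (u + w) N) => h1; case: (ltnP (v + z) N) => h2 /=;
    apply/orP; [left | right | lia | left]; lia.
have {e1 e2} [-> [-> [-> ->]]] : a = v /\ b = z /\ c = u /\ d = w.
  by move: e1 e2; rewrite !modn_small; lia.
rewrite /lift2 /lt2; case: (ltnP (v + z) N) => h1; case: (ltnP (u + w) N) => h2 /=;
  apply/orP; [right | lia | left | right]; lia.
Qed.

Lemma has_crossing_low : has_crossing k.+1 (cover sigma) ->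
  exists2 q, q <= M & h q N (M - q) < M - q.
Proof.
case/existsP=> X /and3P[/subsetP Xs /eqP Xk /forall_inP Xc].
have XO s : s \in X -> s \in Omega n k.
  move=> /Xs /bigcupP[o os so]; have /imsetP[s0 s0O oE] := subsetP sigma_sub _ os.
  move: so; rewrite oE in_set2 => /orP[] /eqP-> //.
  have [a [b [-> ab ba bN]]] := OmegaE polygon_gt0 s0O.
  by rewrite rotate_chord; apply: chord_Omega; lia.
pose c := sort (fun p r : nat * nat => p.1 <= r.1) [seq lift_seg s | s <- enum X].
have cP (p : nat * nat) : p \in c -> exists2 s, s \in X & p = lift_seg s.
  by rewrite mem_sort => /mapP[s]; rewrite mem_enum => sX ->; exists s.
have ok (p : nat * nat) : p \in c -> [&& p.1 + k < p.2, p.2 < p.1 + (M + k),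
    2 * N <= p.1 + p.2, p.1 + p.2 < 3 * N & seg p.1 p.2 \in cover sigma].
  move=> /cP[s sX ->]; have [a [b [sE ab ba bN ->]]] := lift_segP (XO _ sX).
  rewrite seg_lift2 -sE (Xs _ sX) andbT.
  by rewrite /lift2; case: ifP => /=; lia.
have cr (p r : nat * nat) : p \in c -> r \in c -> p != r ->
    [&& lt2 p r, r.1 < p.2 & r.2 < p.1 + N] || [&& lt2 r p, p.1 < r.2 & p.2 < r.1 + N].
  move=> /cP[s sX ->] /cP[s' s'X ->].
  have [a [b [sE ab ba bN ->]]] := lift_segP (XO _ sX).
  have [a' [b' [sE' ab' ba' bN' ->]]] := lift_segP (XO _ s'X).
  move=> ne; apply: crossing_lift2 => //; try lia.
  rewrite -sE -sE'; have /forall_inP/(_ _ s'X)/implyP := Xc _ sX; apply.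
  apply: contraNneq ne => ss; move: sE sE'; rewrite ss => -> /chord_inj.
  rewrite !modn_small; try lia; move=> E.
  by have [-> ->] : a = a' /\ b = b' by lia.
have uc : uniq c.
  rewrite sort_uniq map_inj_in_uniq ?enum_uniq // => s s'; rewrite !mem_enum => sX s'X.
  have [a [b [-> _ _ _ ->]]] := lift_segP (XO _ sX).
  have [a' [b' [-> _ _ _ ->]]] := lift_segP (XO _ s'X).
  by move=> E; rewrite -seg_lift2 E seg_lift2.
apply: (@crossing_low_height n k (fun a b => seg a b \in cover sigma) k_gt0 k_ltn h _ _ _ _ _ _ _ c).
- exact: state_init.
- by move=> q t i; exact: height_mono.
- by move=> q t i; exact: height_lip.
- by [].
- exact: state_top.
- exact: state_idle.
- exact: state_step.
- by rewrite size_sort size_map -cardE Xk.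
(* Distinct lifts are strictly comparable, which excludes ties in the first coordinate; the weakly
   sorted list is therefore a strict chain. *)
- apply: pairwise_sorted.
  have tr : transitive (fun p r : nat * nat => p.1 <= r.1).
    by move=> p r u; exact: leq_trans.
  have : pairwise (fun p r : nat * nat => (p.1 <= r.1) && (p != r)) c.
    rewrite pairwise_relI -uniq_pairwise uc andbT -sorted_pairwise //.
    by apply: sort_sorted => p r; exact: leq_total.
  apply: (sub_in_pairwise (P := mem c)); last by apply/allP.
  move=> p r pc rc /andP[pr ne]; have := cr _ _ pc rc ne; rewrite /lt2.
  by move: pr; lia.
- by apply/allP => p; exact: ok.
move=> p r pc rc; have := ok _ pc; have := ok _ rc.
have [->|ne] := eqVneq p r; first by lia.
by have := cr _ _ pc rc ne; rewrite /lt2; lia.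
Qed.

Lemma state_crossing :
  bruhat m (srev m) (state N) = ~~ has_crossing k.+1 (cover sigma).
Proof.
apply/srev_stateP/negP => [H /has_crossing_low[q qM]|nc q qM]; first by rewrite ltnNge H.
rewrite leqNgt; apply/negP => lt; apply: nc.
have [c [a0 [b0 cs]]] := @low_height_crossing n k (fun a b => seg a b \in cover sigma)
  k_gt0 k_ltn h state_init state_top state_idle state_step q qM lt.
exact: has_crossing_chain cs.
Qed.

End State.

(** * The complex as a spherical subword complex *)

Lemma DstarE : Dstar n k = subword (bruhat m) (sup m) id (word N) (srev m).
Proof.
apply/setP => sigma; rewrite !inE word_orbits; case: (boolP (_ \subset _)) => //= so.
by rewrite -(state_crossing so).
Qed.

Lemma size_filter_word (sigma : {set {set segment n}}) : sigma \subset orbits n k ->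
  size [seq p <- word N | p.1 \notin sigma] + #|sigma| = n * m.
Proof.
move=> /subsetP so; rewrite -size_word size_filter -(count_predC (fun p => p.1 \notin sigma)).
congr (_ + _); rewrite -(count_map fst (predC (fun v => v \notin sigma))) -size_filter.
have /card_uniqP <- := filter_uniq (predC (fun v => v \notin sigma)) word_uniq.
apply: eq_card => v; rewrite mem_filter /= negbK; case: (boolP (v \in sigma)) => //= vs.
by have := so v vs; rewrite -word_orbits inE => ->.
Qed.

(** The word left has [n * m - #|sigma|] letters and the target has length [m * m], so d = n m - m m
    - [#|sigma|], with n m - m m = k m. *)
Lemma link_Dstar_sphere (sigma : {set {set segment n}}) : sigma \in Dstar n k ->
  exists2 d, d + #|sigma| = k * m & homology_sphere d (link (Dstar n k) sigma).
Proof.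
move=> sD; have := sD; rewrite inE => /andP[so nc].
have top : bruhat m (srev m) (state sigma N) by rewrite state_crossing.
have szE := size_filter_word so.
rewrite DstarE in sD *.
rewrite (link_subword (@bruhat_refl m) (@bruhat_trans m) (@signed_sup m) (signed_id m)
  (@sup_sdn m) (@bruhat_sup m) (word_letters N) sD).
set Q := [seq p <- word N | _] in szE *.
have QE : demazure (sup m) id Q set0 = state sigma N.
  by rewrite demazure_filter set0U.
have bot x : signed m x -> bruhat m x id -> bruhat m id x /\ slen m x = 0.
  move=> wx /(le_id wx) E; split; first by apply: bruhat_ext => p pM; rewrite E.
  by rewrite (slen_ext E) slen_id.
have lQ : all (fun p => sletter m p.2) Q.
  by apply/allP => p; rewrite mem_filter => /andP[_ /(allP (word_letters N))].
have uQ : uniq (unzip1 Q).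
  by apply: subseq_uniq word_uniq; apply: map_subseq; exact: filter_subseq.
have topQ : bruhat m (srev m) (demazure (sup m) id Q set0) by rewrite QE.
have [sph _] := subword_homology (@bruhat_refl m) (@bruhat_trans m) (@signed_sup m)
  (@signed_sdn m) (signed_id m) (@sup_sdn m) (@bruhat_sup m) (@sup_idem m) (@sdn_or_sup m)
  (@sup_not_sdn m) bot (@slen_sdn m) lQ uQ (signed_srev m) topQ.
(* [srev] is the maximum, so a product above it agrees with it and the spherical case applies. *)
have [|d dE sD'] := sph.
  rewrite QE; apply: bruhat_ext => p pM.
  by rewrite (ge_srev (signed_state sigma N) top).
have arith a b c e : a + b = n * m -> n * m = c + e -> 2 * d + 2 * e = 2 * a -> d + b = c.
  by lia.
rewrite slen_srev in dE; exists d => //; apply: arith szE _ dE.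
by rewrite -mulnDl subnKC // ltnW.
Qed.

End Word.

Local Open Scope ring_scope.

Theorem theorem3p5 (n k : nat) (hn : (2 <= n)%N) (hk : (1 <= k <= n - 1)%N) :
  (forall sigma : {set {set segment n}}, sigma \in Dstar n k ->
     has_sphere_homology (link (Dstar n k) sigma)
       ((k * (n - k))%N%:Z - 1 - face_dim sigma - 1)) /\
  has_sphere_homology (Dstar n k) ((k * (n - k))%N%:Z - 1).
Proof.
have k_gt0 : (0 < k)%N by lia.
have k_ltn : (k < n)%N by lia.
split=> [sigma sD|].
  have [d dE sph] := link_Dstar_sphere k_gt0 k_ltn sD.
  have -> : (k * (n - k))%N%:Z - 1 - face_dim sigma - 1 = d%:Z - 1.
    by rewrite /face_dim -dE; lia.
  exact: has_sphere_homologyP.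
have D0 : set0 \in Dstar n k.
  rewrite inE sub0set /= /cover big_set0; apply/existsP => -[X /and3P[X0 /eqP Xk _]].
  by move: X0; rewrite subset0 -cards_eq0 Xk.
have [d dE sph] := link_Dstar_sphere k_gt0 k_ltn D0.
rewrite cards0 addn0 in dE; rewrite -dE; apply: has_sphere_homologyP.
(* The whole complex is the link of its empty face. *)
suff <- : link (Dstar n k) set0 = Dstar n k by [].
by apply/setP => F; rewrite !inE setU0 setI0 eqxx andbT andbb.
Qed.
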